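(* Let $\mathcal{H}$ be a separable infinite-dimensional Hilbert space and let $T$ and $T_0$ be two contractions on $\mathcal{H}$ such that $T_0$ is a strict contraction (that is, $\|T_0\|<1$) and $T-T_0\in\mathcal{B}_1(\mathcal{H})$. Then there exists a real-valued function $\xi\in L^1([0,2\pi])$, unique up to an additive constant, such that $$\mathrm{Tr}_{\mathcal{H}}\big\{\phi(T)-\phi(T_0)\big\}=\int_0^{2\pi}\frac{d}{dt}\big\{\phi(e^{it})\big\}\,\xi(t)\,dt$$ for every $\phi\in\mathcal{G}$.
   Context: $\mathcal{H}$ is a complex Hilbert space, $\mathcal{B}(\mathcal{H})$ is the algebra of bounded linear operators on $\mathcal{H}$, and $\mathcal{B}_1(\mathcal{H})$ is the Banach space of trace-class operators on $\mathcal{H}$. $\mathrm{Tr}_{\mathcal{H}}$ denotes the trace of trace-class operators on $\mathcal{H}$ (so the trace identity includes the assertion that the operator inside the trace is trace class). A contraction is an operator $T\in\mathcal{B}(\mathcal{H})$ with $\|T\|\le 1$; it is a strict contraction if $\|T\|<1$. $\mathbb{D}$ is the open unit disc in $\mathbb{C}$. The class $\mathcal{G}$ consists of all functions $\phi(z)=\sum_{k=0}^\infty a_k z^k$ ($z\in\mathbb{D}$) with $a_k\in\mathbb{C}$ and $\sum_{k=0}^\infty |k a_k|<\infty$. For $\phi\in\mathcal{G}$ the series converges absolutely and uniformly on the closed unit disc, so $\phi(e^{it})=\sum_{k\ge0}a_ke^{ikt}$ is defined, and for a contraction $T$ one sets $\phi(T)=\sum_{k=0}^\infty a_kT^k$ (convergent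 in operator norm). Uniqueness up to an additive constant means that any two real-valued $L^1([0,2\pi])$ functions with the stated property (for all $\phi\in\mathcal{G}$) differ almost everywhere by a constant. *)

(* Defs.v *)
From HB Require Import structures.
From mathcomp Require Import all_boot all_order all_algebra.
From mathcomp Require Import all_classical all_reals all_analysis.
From mathcomp Require Import complex sesquilinear.

Set Implicit Arguments.
Unset Strict Implicit.
Unset Printing Implicit Defensive.

Import Order.TTheory GRing.Theory Num.Theory.
Import numFieldNormedType.Exports.

Local Open Scope classical_set_scope.
Local Open Scope complex_scope.
Local Open Scope ring_scope.

(* The library puts the metric structure given by `|_| on generic numeric fields
   only. *)
HB.instance Definition _ (R : realType) :=
  PseudoPointedMetric.copy R[i] R[i]^o.

(* A complex Hilbert space: a complete normed R[i]-module whose norm is induced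
   by an inner product, linear in its first argument and conjugate-linear in its
   second. *)
HB.mixin Record CompleteNormedModule_isHilbert (R : realType) (H : Type)
    & CompleteNormedModule R[i] H := {
  inner : {dot H for (@Num.conj R[i])} ;
  normr_inner : forall x : H, `|x| ^+ 2 = inner x x
}.

#[short(type="hilbertType")]
HB.structure Definition Hilbert (R : realType) :=
  { H of CompleteNormedModule R[i] H & CompleteNormedModule_isHilbert R H }.

Definition separable (T : topologicalType) :=
  exists D : set T, countable D /\ dense D.

Definition finite_dimensional (K : numFieldType) (V : lmodType K) :=
  exists (n : nat) (v : 'I_n -> V),
    forall x : V, exists c : 'I_n -> K, x = \sum_(i < n) c i *: v i.

Section Operators.
Context {R : realType} {H : hilbertType R}.
Implicit Types (S T A : H -> H) (e : nat -> H) (a : nat -> R[i]).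

Definition bounded_operator T := linear T /\ continuous T.

Definition op_norm T : \bar R :=
  ereal_sup [set (complex.Re `|T x|)%:E | x in [set x : H | `|x| <= 1]].

Definition contraction_operator T := bounded_operator T /\ (op_norm T <= 1)%E.

Definition strict_contraction_operator T := bounded_operator T /\ (op_norm T < 1)%E.

Definition is_adjoint T S := forall x y : H, inner (T x) y = inner x (S y).

(* The order of R[i] makes [0 <= z] include that z is real. *)
Definition positive_operator A :=
  bounded_operator A /\ forall x : H, 0 <= inner (A x) x.

(* A = |T|, the positive square root of the composite of T's adjoint with T. *)
Definition is_absolute_value T A :=
  positive_operator A /\
  exists2 S, bounded_operator S /\ is_adjoint T S & A \o A = S \o T.

(* Orthonormal bases are indexed by nat: they are only used in separable
   infinite-dimensional spaces. *)
Definition orthonormal_basis e :=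
  (forall i j, inner (e i) (e j) = (i == j)%:R) /\
  (forall x : H, series (fun k => inner x (e k) *: e k) @ \oo --> x).

Definition trace_class T :=
  bounded_operator T /\
  exists A e, [/\ is_absolute_value T A, orthonormal_basis e &
    (\sum_(0 <= k <oo) (complex.Re (inner (A (e k)) (e k)))%:E < +oo)%E].

(* T is trace class and Tr T = c. *)
Definition is_trace T (c : R[i]) :=
  trace_class T /\
  forall e, orthonormal_basis e ->
    series (fun k => inner (T (e k)) (e k)) @ \oo --> c.

Definition is_op_series a T S :=
  bounded_operator S /\
  op_norm (fun x => S x - \sum_(k < n) a k *: iter k T x) @[n --> \oo] --> 0%E.

(* phi(T), where phi(z) = \sum_k a_k z^k; equals 0 if the series does not
   converge in operator norm. *)
Definition op_fun a T : H -> H := xget (fun=> 0) [set S | is_op_series a T S].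

End Operators.

Section Functions.
Context {R : realType}.
Implicit Types (a : nat -> R[i]) (f : R -> R[i]).

(* A function of the class G is given by its Taylor coefficients a. *)
Definition class_G a := cvgn (series (fun k => `|k%:R * a k|)).

Definition expi (t : R) : R[i] := cos t +i* sin t.

(* t |-> phi(e^{it}) *)
Definition circle_fun a (t : R) : R[i] :=
  limn (series (fun k => a k * expi t ^+ k)).

Definition cderive1 f (t : R) : R[i] :=
  derive1 (fun u => complex.Re (f u)) t +i* derive1 (fun u => complex.Im (f u)) t.

Definition Cintegral (D : set R) f : R[i] :=
  Rintegral lebesgue_measure D (fun u => complex.Re (f u)) +i*
  Rintegral lebesgue_measure D (fun u => complex.Im (f u)).

Definition period : set R := `[0, 2 * pi].

Definition L1_period (xi : R -> R) :=
  lebesgue_measure.-integrable period (EFin \o xi).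

End Functions.

Definition trace_formula (R : realType) (H : hilbertType R) (T T0 : H -> H)
    (xi : R -> R) :=
  forall a : nat -> R[i], class_G a ->
    is_trace (op_fun a T \- op_fun a T0)
      (Cintegral period (fun t => cderive1 (circle_fun a) t * (xi t)%:C)).

(* Main.v *)
(* With r = ||T0|| < 1, the telescoping sum
   T^n - T0^n = sum_i T^(n-1-i) (T - T0) T0^i  has trace norm at most
   ||T - T0||_1 / (1 - r), uniformly in n.  The trace formula for z^n prescribes the
   n-th Fourier coefficient of xi to be, up to a constant factor, Tr(T^n - T0^n) / n;
   reality of xi then prescribes the (-n)-th one, and these coefficients are O(1/n),
   hence square summable, so xi exists by Riesz-Fischer.  Summing over n extends
   the formula to the class G.  All nonzero Fourier coefficients being prescribed,
   two solutions differ by a constant: integrating their difference against the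
   Abel sums of sum_n sin(n (t - x)) / n, which converge boundedly to a sawtooth
   jumping at x, determines its integral over [0, x] for every x.

   Bounds on the trace norm are obtained by testing against pairs of Bessel
   families, a class of tests stable under composition with contractions, the
   resulting bounds being stable under pointwise limits of operators. *)
From HB Require Import structures.
Require Import Defs.
From mathcomp Require Import all_boot all_order all_algebra.
From mathcomp Require Import all_classical all_reals all_analysis.
From mathcomp Require Import measurable_realfun complex sesquilinear ring lra.

Set Implicit Arguments.
Unset Strict Implicit.
Unset Printing Implicit Defensive.

Import Order.TTheory GRing.Theory Num.Theory.
Import numFieldNormedType.Exports.
Local Open Scope classical_set_scope.
Local Open Scope ring_scope.

(** * Complex norms and convergence *)

(** The definition of trace class looks at [|V|] in one orthonormal basis. Since [|S + T|] is not
    dominated by [|S| + |T|], neither sums nor limits can be treated on the definition itself. The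
    way around: a square root [B] of [|V|] and a polar factor [U] give [V = (U B) B], a product of
    two Hilbert-Schmidt operators, and the resulting rank-one expansion yields both the test bound
    and a trace that does not depend on the basis. Conversely, a test bound gives trace class back
    by pairing a basis with its image under [U]. Square root and polar factor are limits of explicit
    iterations in [X = 1 - A/c]; one converges by a scalar majorant, the other by monotonicity of
    the numbers <X^n x, x>.

    On the function side, the O(1/n) decay makes the blocks of frequencies [4^k, 4^(k+1)) have L^1
    norms O(2^-k), so xi is the almost everywhere sum of a series that converges absolutely in L^1.
    Integrals are kept real throughout, a pair of cosine and sine coefficients standing for one
    complex coefficient. *)

Definition nrm (R : rcfType) (V : normedZmodType R[i]) (x : V) : R :=
  complex.Re `|x|.

Section Norm.
Local Open Scope complex_scope.
Variable R : rcfType.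
Implicit Types z w : R[i].

Section NormedZmod.
Variable V : normedZmodType R[i].
Implicit Types x y : V.

(** Norms of [R[i]]-modules are [R[i]]-valued and the order of [R[i]] is partial. Estimates are
    therefore moved through [nrm] to the ordered field [R], where [lra] and real limits apply. *)
Lemma nrmE x : `|x| = (nrm x)%:C.
Proof. by rewrite /nrm RRe_real// ger0_real. Qed.

Lemma nrm_ge0 x : 0 <= nrm x.
Proof. by rewrite -ler0c -nrmE. Qed.

Lemma nrm0 : nrm (0 : V) = 0.
Proof. by apply: complexI; rewrite -nrmE normr0. Qed.

Lemma nrm_eq0 x : (nrm x == 0) = (x == 0).
Proof. by rewrite -(normr_eq0 x) nrmE -(inj_eq (@complexI _)). Qed.

Lemma nrmN x : nrm (- x) = nrm x.
Proof. by rewrite /nrm normrN. Qed.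

Lemma nrmBC x y : nrm (x - y) = nrm (y - x).
Proof. by rewrite /nrm distrC. Qed.

Lemma ler_nrmD x y : nrm (x + y) <= nrm x + nrm y.
Proof. by rewrite -lecR rmorphD /= -!nrmE ler_normD. Qed.

Lemma ler_nrmB x y : nrm (x - y) <= nrm x + nrm y.
Proof. by rewrite -(nrmN y) ler_nrmD. Qed.

Lemma ler_dist_nrm x y : `|nrm x - nrm y| <= nrm (x - y).
Proof.
rewrite ler_norml; apply/andP; split.
  by rewrite lerNl opprB lerBlDr nrmBC -[X in nrm X <= _](subrK x) ler_nrmD.
by rewrite lerBlDr -[X in nrm X <= _](subrK y) ler_nrmD.
Qed.

Lemma ler_nrm_sum (I : Type) (r : seq I) (P : pred I) (F : I -> V) :
  nrm (\sum_(i <- r | P i) F i) <= \sum_(i <- r | P i) nrm (F i).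
Proof.
elim/big_ind2: _ => [|x a y b ha hb|//]; first by rewrite nrm0.
by apply: le_trans (ler_nrmD _ _) _; exact: lerD.
Qed.

End NormedZmod.

Lemma nrmM z w : nrm (z * w) = nrm z * nrm w.
Proof. by apply: complexI; rewrite rmorphM /= -!nrmE normrM. Qed.

Lemma nrm_real (a : R) : nrm (a%:C) = `|a|.
Proof. by rewrite /nrm normc_def /= expr0n addr0 sqrtr_sqr. Qed.

Lemma nrm_natl n z : nrm (n%:R * z) = n%:R * nrm z.
Proof. by rewrite nrmM -(rmorph_nat (real_complex R)) nrm_real normr_nat. Qed.

Lemma nrm1 : nrm (1 : R[i]) = 1.
Proof. by rewrite -(rmorph1 (real_complex R)) nrm_real normr1. Qed.

Lemma nrmJ z : nrm (conjc z : R[i]) = nrm z.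
Proof. by rewrite /nrm normcJ. Qed.

Lemma nrmX z n : nrm (z ^+ n) = nrm z ^+ n.
Proof. by elim: n => [|n IH]; rewrite ?expr0 ?nrm1// !exprS nrmM IH. Qed.

Lemma sqr_nrm z : (nrm z ^+ 2)%:C = z * conjc z.
Proof. by rewrite rmorphXn /= -nrmE sqr_normc. Qed.

Lemma sqr_nrmE z : nrm z ^+ 2 = complex.Re z ^+ 2 + complex.Im z ^+ 2.
Proof. by apply: complexI; rewrite add_Re2_Im2 nrmE rmorphXn. Qed.

Lemma ler_Re_nrm z : `|complex.Re z| <= nrm z.
Proof. by rewrite -lecR -nrmE normc_ge_Re. Qed.

Lemma ler_Im_nrm z : `|complex.Im z| <= nrm z.
Proof.
rewrite -(@ler_pXn2r _ 2)// ?nnegrE ?nrm_ge0//.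
by rewrite sqr_nrmE -normrX ger0_norm ?sqr_ge0// lerDr sqr_ge0.
Qed.

Lemma ler_nrm_ReIm z : nrm z <= `|complex.Re z| + `|complex.Im z|.
Proof.
rewrite -(@ler_pXn2r _ 2)// ?nnegrE ?nrm_ge0 ?addr_ge0//.
rewrite sqr_nrmE sqrrD !real_normK ?num_real// lerD2r lerDl.
by rewrite mulrn_wge0// mulr_ge0.
Qed.

Lemma ReB z w : complex.Re (z - w) = complex.Re z - complex.Re w.
Proof. by case: z => ? ?; case: w. Qed.

Lemma ImB z w : complex.Im (z - w) = complex.Im z - complex.Im w.
Proof. by case: z => ? ?; case: w. Qed.

Lemma nrmZ (V : normedModType R[i]) z (x : V) : nrm (z *: x) = nrm z * nrm x.
Proof. by apply: complexI; rewrite rmorphM /= -!nrmE normrZ. Qed.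

End Norm.

Section Convergence.
Variable R : realType.
Local Open Scope complex_scope.

Lemma cvg_nrmP (V : normedModType R[i]) (u : nat -> V) (l : V) :
  u @ \oo --> l <-> nrm (u n - l) @[n --> \oo] --> (0 : R).
Proof.
split => [/cvgrPdist_lt ul|/cvgrPdist_lt ul].
  apply/cvgrPdist_lt => e e0; near=> n.
  rewrite sub0r normrN ger0_norm ?nrm_ge0// nrmBC -ltcR -nrmE.
  by near: n; apply: ul; rewrite ltcE /= eqxx.
(* A positive element of [R[i]] is real, so the imaginary part [e'] vanishes. *)
apply/cvgrPdist_lt => e; case: e => e e'; rewrite ltcE /= => /andP[/eqP -> e0].
near=> n; rewrite complexr0 nrmE ltcR nrmBC.
have : `|0 - nrm (u n - l)| < e by near: n; exact: ul.
by rewrite sub0r normrN ger0_norm ?nrm_ge0.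
Unshelve. all: by end_near. Qed.

Lemma cvg_complex_nrmP (u : nat -> R[i]) (l : R[i]) :
  u @ \oo --> l <-> nrm (u n - l) @[n --> \oo] --> (0 : R).
Proof. exact: (@cvg_nrmP R[i]^o). Qed.

Lemma nrm_cauchy_cvg (V : completeNormedModType R[i]) (u : nat -> V) :
  (forall e : R, 0 < e -> exists N, forall n m, (N <= n)%N -> (N <= m)%N ->
     nrm (u n - u m) < e) -> cvgn u.
Proof.
move=> uc; apply/cauchy_cvgP/cauchy_ballP => e.
case: e => e e'; rewrite ltcE /= => /andP[/eqP -> e0].
have [N uN] := uc _ e0; exists (u @` [set n | (N <= n)%N], u @` [set n | (N <= n)%N]).
  by split; exists N => // n /= Nn; exists n.
move=> [_ _] [/= [n /= Nn <-] [m /= Nm <-]].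
by rewrite -ball_normE /ball_ /= complexr0 nrmE ltcR; exact: uN.
Qed.

Lemma real_cauchy_cvg (u : nat -> R) :
  (forall e : R, 0 < e -> exists N, forall n m, (N <= n)%N -> (N <= m)%N ->
     `|u n - u m| < e) -> cvgn u.
Proof.
move=> uc; apply/cauchy_cvgP/cauchy_ballP => e e0.
have [N uN] := uc _ e0; exists (u @` [set n | (N <= n)%N], u @` [set n | (N <= n)%N]).
  by split; exists N => // n /= Nn; exists n.
move=> [_ _] [/= [n /= Nn <-] [m /= Nm <-]].
by rewrite -ball_normE /ball_ /=; exact: uN.
Qed.

Lemma cvg_ReIm (u : nat -> R[i]) (l : R[i]) :
  (fun n => complex.Re (u n)) @ \oo --> complex.Re l ->
  (fun n => complex.Im (u n)) @ \oo --> complex.Im l -> u @ \oo --> l.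
Proof.
move=> /cvgrPdist_lt ul /cvgrPdist_lt vl; apply/cvg_complex_nrmP/cvgrPdist_lt => e e0.
near=> n; rewrite sub0r normrN ger0_norm ?nrm_ge0// nrmBC.
rewrite (le_lt_trans (ler_nrm_ReIm _))// ReB ImB (splitr e) ltrD//; near: n.
  by apply: ul; rewrite divr_gt0.
by apply: vl; rewrite divr_gt0.
Unshelve. all: by end_near. Qed.

Lemma cvg_Re (u : nat -> R[i]) (l : R[i]) : u @ \oo --> l ->
  (fun n => complex.Re (u n)) @ \oo --> complex.Re l.
Proof.
move=> /cvg_complex_nrmP/cvgrPdist_lt ul; apply/cvgrPdist_lt => e e0; near=> n.
rewrite -ReB (le_lt_trans (ler_Re_nrm _))// nrmBC.
have : `|0 - nrm (u n - l)| < e by near: n; exact: ul.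
by rewrite sub0r normrN ger0_norm ?nrm_ge0.
Unshelve. all: by end_near. Qed.

Lemma cvg_Im (u : nat -> R[i]) (l : R[i]) : u @ \oo --> l ->
  (fun n => complex.Im (u n)) @ \oo --> complex.Im l.
Proof.
move=> /cvg_complex_nrmP/cvgrPdist_lt ul; apply/cvgrPdist_lt => e e0; near=> n.
rewrite -ImB (le_lt_trans (ler_Im_nrm _))// nrmBC.
have : `|0 - nrm (u n - l)| < e by near: n; exact: ul.
by rewrite sub0r normrN ger0_norm ?nrm_ge0.
Unshelve. all: by end_near. Qed.

Lemma complex_cauchy_cvg (u : nat -> R[i]) :
  (forall e : R, 0 < e -> exists N, forall n m, (N <= n)%N -> (N <= m)%N ->
     nrm (u n - u m) < e) -> exists l : R[i], u @ \oo --> l.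
Proof.
move=> uc.
have /cvg_ex[a ua] : cvgn (fun n => complex.Re (u n)).
  apply: real_cauchy_cvg => e /uc[N hN]; exists N => n m Nn Nm.
  by rewrite -ReB (le_lt_trans (ler_Re_nrm _))// hN.
have /cvg_ex[b ub] : cvgn (fun n => complex.Im (u n)).
  apply: real_cauchy_cvg => e /uc[N hN]; exists N => n m Nn Nm.
  by rewrite -ImB (le_lt_trans (ler_Im_nrm _))// hN.
by exists (a +i* b); exact: cvg_ReIm.
Qed.

Lemma cvg_complexD (u v : nat -> R[i]) (a b : R[i]) : u @ \oo --> a -> v @ \oo --> b ->
  (fun n => u n + v n) @ \oo --> a + b.
Proof.
move=> ua vb; apply: cvg_ReIm; rewrite raddfD; under eq_fun do rewrite raddfD.
  by apply: cvgD; exact: cvg_Re.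
by apply: cvgD; exact: cvg_Im.
Qed.

Lemma cvg_complexMl (u : nat -> R[i]) (a c : R[i]) : u @ \oo --> a ->
  (fun n => c * u n) @ \oo --> c * a.
Proof.
move=> /cvg_complex_nrmP ua; apply/cvg_complex_nrmP.
under eq_fun do rewrite -mulrBr nrmM.
by rewrite -(mulr0 (nrm c)); exact: cvgMr.
Qed.

Lemma cvg_complex_unique (u : nat -> R[i]) (a b : R[i]) :
  u @ \oo --> a -> u @ \oo --> b -> a = b.
Proof.
move=> ua ub; apply/eqP; rewrite eq_complex; apply/andP; split; apply/eqP.
  by rewrite -(cvg_lim (@Rhausdorff R) (cvg_Re ua)) -(cvg_lim (@Rhausdorff R) (cvg_Re ub)).
by rewrite -(cvg_lim (@Rhausdorff R) (cvg_Im ua)) -(cvg_lim (@Rhausdorff R) (cvg_Im ub)).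
Qed.

End Convergence.

(** * Hilbert spaces and bounded operators *)

Section Inner.
Local Open Scope complex_scope.
Variables (R : realType) (H : hilbertType R).
Implicit Types (x y z : H) (c d : R[i]).

Lemma innerDl x y z : inner (x + y) z = inner x z + inner y z.
Proof. exact: linearDl. Qed.
Lemma innerDr x y z : inner x (y + z) = inner x y + inner x z.
Proof. exact: linearDr. Qed.
Lemma innerBl x y z : inner (x - y) z = inner x z - inner y z.
Proof. exact: linearBl. Qed.
Lemma innerBr x y z : inner x (y - z) = inner x y - inner x z.
Proof. exact: linearBr. Qed.
Lemma inner0l x : inner 0 x = 0. Proof. exact: linear0l. Qed.
Lemma inner0r x : inner x 0 = 0. Proof. exact: linear0r. Qed.
Lemma innerZl c x y : inner (c *: x) y = c * inner x y.
Proof. exact: linearZl_LR. Qed.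
Lemma innerC x y : inner x y = conjc (inner y x).
Proof. by rewrite (hermC inner x y) expr0 mul1r. Qed.
Lemma innerZr c x y : inner x (c *: y) = conjc c * inner x y.
Proof. by rewrite innerC innerZl rmorphM /= -innerC. Qed.

Lemma inner_suml (I : Type) (r : seq I) (P : pred I) (F : I -> H) y :
  inner (\sum_(i <- r | P i) F i) y = \sum_(i <- r | P i) inner (F i) y.
Proof. by elim/big_rec2: _ => [|i a b _ <-]; rewrite ?inner0l ?innerDl. Qed.
Lemma inner_sumr (I : Type) (r : seq I) (P : pred I) (F : I -> H) y :
  inner y (\sum_(i <- r | P i) F i) = \sum_(i <- r | P i) inner y (F i).
Proof. by elim/big_rec2: _ => [|i a b _ <-]; rewrite ?inner0r ?innerDr. Qed.

Lemma inner_nrm x : inner x x = (nrm x ^+ 2)%:C.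
Proof. by rewrite -normr_inner nrmE rmorphXn. Qed.

Lemma nrm_innerC x y : nrm (inner x y) = nrm (inner y x).
Proof. by rewrite innerC nrmJ. Qed.

Lemma conjcM c d : conjc (c * d) = conjc c * conjc d.
Proof. exact: rmorphM. Qed.

Lemma Re_addJ c : (2 * complex.Re c)%:C = c + conjc c.
Proof. by rewrite addcJ rmorphM rmorph_nat. Qed.

Lemma nrm_sqrB x y :
  nrm (x - y) ^+ 2 = nrm x ^+ 2 + nrm y ^+ 2 - 2 * complex.Re (inner x y).
Proof.
apply: complexI; rewrite -inner_nrm innerBl !innerBr !inner_nrm (innerC y x).
rewrite rmorphB rmorphD /= Re_addJ; ring.
Qed.

Lemma cauchy_schwarz x y : nrm (inner x y) <= nrm x * nrm y.
Proof.
have [->|y0] := eqVneq y 0; first by rewrite inner0r !nrm0 mulr0.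
have ny : 0 < nrm y by rewrite lt_neqAle nrm_ge0 andbT eq_sym nrm_eq0.
rewrite -(@ler_pXn2r _ 2)// ?nnegrE ?mulr_ge0 ?nrm_ge0//.
(* [c *: y] is the orthogonal projection of [x] on the line spanned by [y]. *)
set c := inner x y * ((nrm y ^+ 2)^-1)%:C.
have := sqr_ge0 (nrm (x - c *: y)).
have -> : nrm (x - c *: y) ^+ 2 = nrm x ^+ 2 - nrm (inner x y) ^+ 2 / nrm y ^+ 2.
  apply: complexI; rewrite -inner_nrm innerBl !innerBr !(innerZl, innerZr) !inner_nrm.
  rewrite (innerC y x) /c conjcM conjc_real rmorphB [X in _ = _ - X]rmorphM /= sqr_nrm.
  set a := inner x y; set b := conjc a.
  have h : ((nrm y ^+ 2)^-1)%:C * (nrm y ^+ 2)%:C = 1.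
    by rewrite -rmorphM /= mulVf// expf_neq0// gt_eqF.
  have h2 : (nrm y ^+ 2)%:C * ((nrm y ^+ 2)^-1)%:C = 1 by rewrite mulrC.
  rewrite -(mulrA _ ((nrm y ^+ 2)^-1)%:C (_ * (nrm y ^+ 2)%:C)).
  rewrite (mulrCA ((nrm y ^+ 2)^-1)%:C) -(mulrA b) h.
  ring: h.
by rewrite subr_ge0 ler_pdivrMr ?exprn_gt0// exprMn.
Qed.

Lemma inner_eq x y : (forall z, inner z x = inner z y) -> x = y.
Proof.
move=> h; apply/eqP; rewrite -subr_eq0 -nrm_eq0 -sqrf_eq0.
by rewrite -(inj_eq (@complexI _)) -inner_nrm innerBr h subrr.
Qed.

End Inner.

Section BoundedOperators.
Local Open Scope complex_scope.
Variables (R : realType) (H : hilbertType R).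
Implicit Types (x y z : H) (c : R[i]) (T S : H -> H) (C : R).

(** An explicit real constant composes more easily than the [\bar R]-valued [op_norm], which appears
    only where contractions and operator-norm series enter. *)
Definition bounded_by T C := linear T /\ forall x, nrm (T x) <= C * nrm x.

Lemma bounded_byP T : bounded_operator T -> exists2 C, 0 < C & bounded_by T C.
Proof.
move=> [Tl Tc].
pose f : {linear H -> H} :=
  HB.pack T (GRing.isLinear.Build _ _ _ _ T Tl).
have := @continuous_linear_bounded _ _ _ 0 f (Tc 0).
move=> /linear_boundedP /pinfty_ex_gt0[r r0 fr].
have rE : r = (complex.Re r)%:C by rewrite RRe_real// gtr0_real.
exists (complex.Re r); first by rewrite -ltcR -rE.
by split => // x; rewrite -lecR rmorphM /= -!nrmE -rE; exact: fr.
Qed.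

Lemma bounded_by_operator T C : bounded_by T C -> bounded_operator T.
Proof.
move=> [Tl TC]; split => //.
pose f : {linear H -> H} :=
  HB.pack T (GRing.isLinear.Build _ _ _ _ T Tl).
apply: (@bounded_linear_continuous _ _ _ f); apply/linear_boundedP.
near=> r => x; apply: (@le_trans _ _ (`|C|%:C * `|x|)).
  by rewrite /= !nrmE -rmorphM lecR (le_trans (TC x))// ler_wpM2r ?nrm_ge0 ?ler_norm.
apply: ler_wpM2r => //; near: r; apply: nbhs_pinfty_ge.
by rewrite complex_real.
Unshelve. all: by end_near. Qed.

Section Linear.
Variable T : H -> H.
Hypothesis Tl : linear T.
Lemma lin0 : T 0 = 0.
Proof. by have /esym/eqP := Tl 1 0 0; rewrite !scale1r addr0 -subr_eq0 addrK => /eqP. Qed.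
Lemma linZ c x : T (c *: x) = c *: T x.
Proof. by have := Tl c x 0; rewrite lin0 !addr0. Qed.
Lemma linD x y : T (x + y) = T x + T y.
Proof. by have := Tl 1 x y; rewrite !scale1r. Qed.
Lemma linB x y : T (x - y) = T x - T y.
Proof. by rewrite linD -scaleN1r linZ scaleN1r. Qed.
Lemma lin_sum (I : Type) (r : seq I) (P : pred I) (F : I -> H) :
  T (\sum_(i <- r | P i) F i) = \sum_(i <- r | P i) T (F i).
Proof. by elim/big_rec2: _ => [|i a b _ <-]; rewrite ?lin0 ?linD. Qed.
End Linear.

Lemma bounded_byW T C D : C <= D -> bounded_by T C -> bounded_by T D.
Proof. by move=> CD [? h]; split => // x; rewrite (le_trans (h x))// ler_wpM2r ?nrm_ge0. Qed.

Lemma bounded_by_id : bounded_by (@idfun H) 1.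
Proof. by split=> // x; rewrite mul1r. Qed.

Lemma bounded_by0 : bounded_by (fun=> 0 : H) 0.
Proof. by split=> [c x y|x]; rewrite ?scaler0 ?addr0// mul0r nrm0. Qed.

Lemma bounded_byD T S C D : bounded_by T C -> bounded_by S D ->
  bounded_by (fun x => T x + S x) (C + D).
Proof.
move=> [Tl TC] [Sl SD]; split=> [c x y|x].
  by rewrite Tl Sl scalerDr addrACA.
by rewrite mulrDl (le_trans (ler_nrmD _ _))// lerD.
Qed.

Lemma bounded_byZ T C c : bounded_by T C -> bounded_by (fun x => c *: T x) (nrm c * C).
Proof.
move=> [Tl TC]; split=> [d x y|x].
  by rewrite Tl scalerDr !scalerA (mulrC c).
by rewrite nrmZ -mulrA ler_wpM2l ?nrm_ge0.
Qed.

Lemma bounded_byB T S C D : bounded_by T C -> bounded_by S D ->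
  bounded_by (fun x => T x - S x) (C + D).
Proof.
move=> bT bS; have := bounded_byD bT (bounded_byZ (-1) bS).
rewrite nrmN nrm1 mul1r => -[? h]; split => [c x y|x].
  by rewrite (proj1 bT) (proj1 bS) opprD scalerBr addrACA.
by have := h x; rewrite scaleN1r.
Qed.

Lemma bounded_by_comp T S C D : 0 <= C -> bounded_by T C -> bounded_by S D ->
  bounded_by (T \o S) (C * D).
Proof.
move=> C0 [Tl TC] [Sl SD]; split=> [c x y|x] /=; first by rewrite Sl Tl.
by rewrite (le_trans (TC _))// -mulrA ler_wpM2l.
Qed.

Lemma bounded_by_iter T C n : 0 <= C -> bounded_by T C ->
  bounded_by (iter n T) (C ^+ n).
Proof.
move=> C0 bT; elim: n => [|n IH]; first exact: bounded_by_id.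
by rewrite exprS; exact: bounded_by_comp.
Qed.

Lemma bounded_by_cvg T C (u : nat -> H) x : bounded_by T C ->
  u @ \oo --> x -> T \o u @ \oo --> T x.
Proof.
by move=> /bounded_by_operator[_ Tc] ux; apply: continuous_cvg => //; exact: Tc.
Qed.

Lemma op_norm_le T C : linear T -> (op_norm T <= C%:E)%E -> bounded_by T C.
Proof.
move=> Tl TC; split => // x; have [->|x0] := eqVneq x 0.
  by rewrite lin0// !nrm0 mulr0.
have nx : 0 < nrm x by rewrite lt_neqAle nrm_ge0 andbT eq_sym nrm_eq0.
have : ((nrm (T ((nrm x)^-1%:C *: x)))%:E <= C%:E)%E.
  apply: le_trans TC; apply: ereal_sup_ubound; exists ((nrm x)^-1%:C *: x) => //=.
  rewrite nrmE nrmZ nrm_real ger0_norm ?invr_ge0 ?nrm_ge0// mulVf ?gt_eqF//.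
rewrite lee_fin linZ// nrmZ nrm_real ger0_norm ?invr_ge0 ?nrm_ge0//.
by rewrite ler_pdivrMl// mulrC.
Qed.

Lemma op_norm_ub T C : 0 <= C -> (forall x, nrm (T x) <= C * nrm x) -> (op_norm T <= C%:E)%E.
Proof.
move=> C0 TC; apply: ub_ereal_sup => _ /= [x + <-].
rewrite nrmE -[1]/(1%:C) lecR lee_fin => x1.
by rewrite (le_trans (TC _))// ler_piMr.
Qed.

End BoundedOperators.

Section Series.
Variable R : realType.
Implicit Types u : nat -> R.

(** This is how limits get identified below: the norm of a difference, or the excess over a bound,
    is dominated by a null sequence. *)
Lemma cvg0_le (a K : R) u : (forall n, a <= K * u n) -> u @ \oo --> (0 : R) -> a <= 0.
Proof.
move=> h u0; have Ku : (fun n => K * u n) @ \oo --> K * 0 by exact: cvgMr.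
rewrite -[leRHS](mulr0 K) -(cvg_lim (@Rhausdorff R) Ku); apply: limr_ge; first exact: cvgP Ku.
by near=> n; exact: h.
Unshelve. all: by end_near. Qed.

Lemma ler_cvgn_const u a b : (forall n, u n <= b) -> u @ \oo --> a -> a <= b.
Proof.
move=> h u0; rewrite -(cvg_lim (@Rhausdorff R) u0); apply: limr_le; first exact: cvgP u0.
by near=> n; exact: h.
Unshelve. all: by end_near. Qed.

Lemma nneg_series_le u a n : (forall k, 0 <= u k) -> series u @ \oo --> a ->
  \sum_(0 <= k < n) u k <= a.
Proof.
move=> u0 ua; rewrite -(cvg_lim (@Rhausdorff R) ua).
apply: nondecreasing_cvgn_le; last exact: cvgP ua.
by apply/nondecreasing_seqP => m; rewrite /series /= big_nat_recr//= lerDl.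
Qed.

Lemma nneg_series_cvg u M : (forall k, 0 <= u k) ->
  (forall n, \sum_(0 <= k < n) u k <= M) -> cvgn (series u).
Proof.
move=> u0 uM; apply: nondecreasing_is_cvgn.
  by apply/nondecreasing_seqP => m; rewrite /series /= big_nat_recr//= lerDl.
by exists M => _ [n _ <-]; exact: uM.
Qed.

Lemma cvg0_eventually u (e : R) : u @ \oo --> (0 : R) -> 0 < e ->
  exists N, forall n, (N <= n)%N -> u n < e.
Proof.
move=> /cvgrPdist_lt/(_ e) + e0 => /(_ e0)[N _ h]; exists N => n Nn.
by have := h n Nn; rewrite sub0r normrN; exact: le_lt_trans (ler_norm _).
Qed.

Lemma eventually_cvg0 u : (forall n, 0 <= u n) ->
  (forall e : R, 0 < e -> exists N, forall n, (N <= n)%N -> u n <= e) ->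
  u @ \oo --> (0 : R).
Proof.
move=> u0 h; apply/cvgrPdist_le => e /h[N hN].
by exists N => // n Nn; rewrite sub0r normrN ger0_norm//; exact: hN.
Qed.

Lemma nneg_series_tail u (e : R) : (forall k, 0 <= u k) -> cvgn (series u) -> 0 < e ->
  exists N, forall n m, (N <= n)%N -> \sum_(n <= k < m) u k < e.
Proof.
move=> u0 /cvg_ex[a ua] e0.
have : (fun n => a - series u n) @ \oo --> (0 : R).
  by rewrite -(subrr a); apply: cvgB => //; exact: cvg_cst.
move=> /cvg0_eventually/(_ e0)[N hN]; exists N => n m Nn.
have [mn|nm] := leqP m n; first by rewrite big_geq.
apply: le_lt_trans (hN n Nn); rewrite lerBrDl /series /=.
by rewrite -big_cat_nat//= 1?ltnW//; exact: nneg_series_le.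
Qed.

Lemma complex_series_cvg (x : nat -> R[i]) u M : (forall k, nrm (x k) <= u k) ->
  (forall n, \sum_(0 <= k < n) u k <= M) -> exists l : R[i], series x @ \oo --> l.
Proof.
move=> xu uM.
have u0 k : 0 <= u k by exact: le_trans (nrm_ge0 _) (xu k).
apply: complex_cauchy_cvg => d d0.
have [N hN] := nneg_series_tail u0 (nneg_series_cvg u0 uM) d0.
have {}hN n m : (N <= n)%N -> (n <= m)%N -> nrm (series x m - series x n) < d.
  move=> Nn nm; rewrite /series /= (big_cat_nat (leq0n n) nm)/= addrAC subrr add0r.
  rewrite (le_lt_trans (ler_nrm_sum _ _ _))// (le_lt_trans _ (hN n m Nn))//.
  by apply: ler_sum => j _; exact: xu.
exists N => n m Nn Nm; have [nm|/ltnW mn] := leqP n m; last exact: hN.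
by rewrite nrmBC; exact: hN.
Qed.

End Series.

(** * Orthonormal expansions and existence of adjoints *)

Section OrthonormalBasis.
Local Open Scope complex_scope.
Variables (R : realType) (H : hilbertType R) (e : nat -> H).
Implicit Types (x y z : H) (c : nat -> R[i]) (T S : H -> H) (C : R).
Hypothesis eONB : orthonormal_basis e.

Lemma onb_sum_coef c m n j : (m <= j < n)%N ->
  inner (\sum_(m <= k < n) c k *: e k) (e j) = c j.
Proof.
move=> /andP[mj jn]; have [oe _] := eONB; rewrite inner_suml.
rewrite (bigD1_seq j) ?mem_index_iota ?iota_uniq ?mj ?jn//=.
rewrite innerZl oe eqxx mulr1 big1 ?addr0// => k kj.
by rewrite innerZl oe (negbTE kj) mulr0.
Qed.

Lemma onb_sum_sqr c m n :
  nrm (\sum_(m <= k < n) c k *: e k) ^+ 2 = \sum_(m <= k < n) nrm (c k) ^+ 2.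
Proof.
apply: complexI; rewrite -inner_nrm {1}inner_suml rmorph_sum.
apply: eq_big_nat => k kmn; rewrite innerZl innerC onb_sum_coef//.
by rewrite -sqr_nrm.
Qed.

Lemma parseval x :
  series (fun k => nrm (inner x (e k)) ^+ 2) @ \oo --> nrm x ^+ 2.
Proof.
have [_ /(_ x) /cvg_nrmP ex] := eONB.
have h : (fun n => nrm (series (fun k => inner x (e k) *: e k) n)) @ \oo --> nrm x.
  apply/cvgrPdist_le => d d0; have [N hN] := cvg0_eventually ex d0.
  exists N => // n Nn; rewrite (le_trans (ler_dist_nrm _ _))// nrmBC ltW//.
  exact: hN.
under eq_cvg do rewrite /series /= -onb_sum_sqr expr2.
by rewrite expr2; exact: cvgM.
Qed.

Lemma bessel_onb x n : \sum_(0 <= k < n) nrm (inner x (e k)) ^+ 2 <= nrm x ^+ 2.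
Proof.
exact: (@nneg_series_le _ (fun k => nrm (inner x (e k)) ^+ 2) _ n (fun k => sqr_ge0 _) (@parseval x)).
Qed.

Lemma parseval_inner x y :
  series (fun k => inner x (e k) * inner (e k) y) @ \oo --> inner x y.
Proof.
have [_ /(_ x) /cvg_nrmP ex] := eONB; apply/cvg_complex_nrmP.
apply: (@squeeze_cvgr _ _ _ _ (fun=> 0)
  (fun n => nrm (series (fun k => inner x (e k) *: e k) n - x) * nrm y)).
- near=> n; rewrite nrm_ge0/= (le_trans _ (cauchy_schwarz _ _))//.
  rewrite innerBl /series /= inner_suml.
  by under [X in _ <= nrm (X - _)]eq_bigr do rewrite innerZl.
- exact: cvg_cst.
- by rewrite -(mul0r (nrm y)); exact: cvgMl.
Unshelve. all: by end_near. Qed.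

Lemma onb_sum_cvg c M : (forall n, \sum_(0 <= k < n) nrm (c k) ^+ 2 <= M) ->
  exists z, forall k, inner z (e k) = c k.
Proof.
move=> cM; have c0 k : 0 <= nrm (c k) ^+ 2 by exact: sqr_ge0.
have /cvg_ex[z cz] : cvgn (series (fun k => c k *: e k)).
  apply: nrm_cauchy_cvg => d d0.
  have [N hN] := nneg_series_tail c0 (nneg_series_cvg c0 cM) (exprn_gt0 2 d0).
  have {}hN n m : (N <= n)%N -> (n <= m)%N -> nrm (series (fun k => c k *: e k) m -
      series (fun k => c k *: e k) n) < d.
    move=> Nn nm; rewrite /series /= (big_cat_nat (leq0n n) nm)/= addrAC subrr add0r.
    rewrite -(@ltr_pXn2r _ 2)// ?nnegrE ?nrm_ge0 ?ltW// onb_sum_sqr; exact: hN.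
  exists N => n m Nn Nm; have [nm|/ltnW mn] := leqP n m; last exact: hN.
  by rewrite nrmBC; exact: hN.
exists z => k; have /cvg_nrmP cz' := cz.
apply/eqP; rewrite -subr_eq0 -nrm_eq0 eq_le nrm_ge0 andbT.
(* The shift by [k.+1] puts the index [k] inside every partial sum, whose coefficient along [e k] is
   then exactly [c k]. *)
apply: (@cvg0_le _ _ 1 (fun n => nrm (series (fun k => c k *: e k) (n + k.+1)%N - z))); last first.
  by rewrite (cvg_shiftn k.+1 (fun n => nrm (series (fun k => c k *: e k) n - z))); exact: cz'.
move=> n; rewrite mul1r -(@onb_sum_coef c 0 (n + k.+1) k) ?addnS ?ltnS ?leq_addl//.
rewrite -innerBl nrmBC (le_trans (cauchy_schwarz _ _))//.
have : nrm (e k) ^+ 2 = 1.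
  by apply: complexI; rewrite -inner_nrm (proj1 eONB) eqxx.
move=> /eqP; rewrite sqrf_eq1 => /orP[/eqP ->|/eqP h]; first by rewrite mulr1 nrmBC.
by have := nrm_ge0 (e k); rewrite h ler0N1.
Qed.

(** The adjoint is built from its coefficients <y, T e_k>. They are square summable: with [s] a
    partial sum of their squares and [z] the corresponding partial expansion, s = <y, T z> <= C |y|
    |z| and |z|^2 = s, so s <= (C |y|)^2. *)
Lemma adjoint_exists T C : 0 <= C -> bounded_by T C ->
  exists S, is_adjoint T S.
Proof.
move=> C0 [Tl TC].
have ey y : exists z, forall k, inner z (e k) = inner y (T (e k)).
  apply: (@onb_sum_cvg _ ((C * nrm y) ^+ 2)) => n.
  set s := \sum_(_ <= _ < _) _.
  pose z := \sum_(0 <= k < n) inner y (T (e k)) *: e k.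
  have zs : nrm z ^+ 2 = s by exact: onb_sum_sqr.
  have : s <= nrm y * (C * nrm z).
    apply: le_trans (_ : nrm (inner y (T z)) <= _); last first.
      by rewrite (le_trans (cauchy_schwarz _ _))// ler_wpM2l ?nrm_ge0.
    suff -> : inner y (T z) = s%:C.
      by rewrite nrm_real ler_norm.
    rewrite /z (lin_sum Tl) inner_sumr rmorph_sum /=; apply: eq_bigr => k _.
    by rewrite (linZ Tl) innerZr mulrC -sqr_nrm.
  rewrite -zs expr2; have := nrm_ge0 z; rewrite le_eqVlt => /orP[/eqP <- _|z0].
    by rewrite mul0r sqr_ge0.
  rewrite mulrA ler_pM2r// (mulrC _ C) => h; rewrite -expr2 ler_pXn2r ?nnegrE ?nrm_ge0//.
  by rewrite mulr_ge0 ?nrm_ge0.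
pose S y := xget 0 [set z | forall k, inner z (e k) = inner y (T (e k))].
have SE y k : inner (S y) (e k) = inner y (T (e k)).
  by rewrite /S; case: xgetP => [z _ /(_ k)//|h]; case: (ey y) => z /h.
exists S => x y; apply/eqP; rewrite -subr_eq0 -nrm_eq0 eq_le nrm_ge0 andbT.
have [_ /(_ x) /cvg_nrmP ex] := eONB.
apply: (@cvg0_le _ _ (C * nrm y + nrm (S y)) _ _ ex) => n.
set xn := series _ _.
(* The adjoint identity is exact on the partial expansions [xn], so only the remainder [x - xn]
   contributes. *)
have -> : inner (T x) y - inner x (S y) = inner (T (x - xn)) y - inner (x - xn) (S y).
  rewrite (linB Tl) !innerBl.
  have -> : inner (T xn) y = inner xn (S y).
    rewrite /xn /series /= (lin_sum Tl) !inner_suml; apply: eq_bigr => k _.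
    by rewrite (linZ Tl) !innerZl (innerC (e k)) SE -innerC.
  by rewrite opprB addrA subrK.
rewrite (le_trans (ler_nrmB _ _))// mulrDl lerD//.
  by rewrite (le_trans (cauchy_schwarz _ _))// mulrAC ler_wpM2r ?nrm_ge0// nrmBC TC.
by rewrite (le_trans (cauchy_schwarz _ _))// mulrC nrmBC.
Qed.

End OrthonormalBasis.

Section Adjoint.
Variables (R : realType) (H : hilbertType R).
Implicit Types (x y z : H) (T S : H -> H) (C : R).

Lemma adjoint_sym T S : is_adjoint T S -> is_adjoint S T.
Proof. by move=> TS x y; rewrite innerC -TS -innerC. Qed.

Lemma adjoint_bounded T S C : 0 <= C -> bounded_by T C -> is_adjoint T S -> bounded_by S C.
Proof.
move=> C0 [Tl TC] TS; split=> [c x y|x].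
  apply: inner_eq => z; rewrite -TS innerDr innerZr !TS.
  by rewrite innerDr innerZr.
have [->|/negP S0] := eqVneq (nrm (S x)) 0; first by rewrite mulr_ge0 ?nrm_ge0.
have nS : 0 < nrm (S x) by rewrite lt_neqAle nrm_ge0 andbT eq_sym; exact/negP.
rewrite -(ler_pM2r nS) -expr2.
have -> : nrm (S x) ^+ 2 = nrm (inner (S x) (S x)).
  by rewrite inner_nrm nrm_real ger0_norm ?sqr_ge0.
rewrite -TS (le_trans (cauchy_schwarz _ _))// mulrC (mulrC C) -mulrA.
by rewrite ler_wpM2l ?nrm_ge0.
Qed.

End Adjoint.

(** * Square roots and polar decomposition *)

Section Limits.
Variables (R : realType) (H : hilbertType R).
Implicit Types (x y z w : H) (u v : nat -> H) (A : H -> H).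
Local Open Scope complex_scope.

Lemma nrm_le0_eq (x y : H) : nrm (x - y) <= 0 -> x = y.
Proof. by move=> h; apply/eqP; rewrite -subr_eq0 -nrm_eq0 eq_le h nrm_ge0. Qed.

Lemma inner_cvg_eq u v x y z w : u @ \oo --> x -> v @ \oo --> y ->
  (forall n, inner (u n) z = inner w (v n)) -> inner x z = inner w y.
Proof.
move=> /cvg_nrmP ux /cvg_nrmP vy h; apply/eqP; rewrite -subr_eq0 -nrm_eq0.
rewrite eq_le nrm_ge0 andbT.
apply: (@cvg0_le _ _ 1 (fun n => nrm (u n - x) * nrm z + nrm w * nrm (v n - y))).
  move=> n; rewrite mul1r.
  have -> : inner x z - inner w y = inner w (v n - y) - inner (u n - x) z.
    by rewrite innerBl innerBr h; ring.
  by rewrite (le_trans (ler_nrmB _ _))// addrC lerD ?cauchy_schwarz.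
rewrite -[X in _ --> X]addr0 -[X in _ --> X + _](mul0r (nrm z)) -[X in _ --> _ + X](mulr0 (nrm w)).
by apply: cvgD; [exact: cvgMl|exact: cvgMr].
Qed.

Lemma bounded_by_lim (F : nat -> H -> H) (C : R) (G : H -> H) :
  (forall n, bounded_by (F n) C) -> (forall x, F ^~ x @ \oo --> G x) ->
  bounded_by G C.
Proof.
move=> FC FG; split=> [c x y|x].
  apply: (cvg_unique _ (FG (c *: x + y))); first exact: norm_hausdorff.
  rewrite (_ : F ^~ _ = fun n => c *: F n x + F n y).
    by apply: cvgD; [exact: cvgZr|].
  by apply/funext => n; rewrite (proj1 (FC n)).
have /cvg_nrmP := FG x; rewrite -subr_le0 => h.
apply: (@cvg0_le _ _ 1 _ _ h) => n; rewrite mul1r lerBlDl.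
rewrite -{1}(subrK (F n x) (G x)) (le_trans (ler_nrmD _ _))// addrC lerD//.
  exact: (proj2 (FC n)).
by rewrite nrmBC.
Qed.

End Limits.

Section Positive.
Variables (R : realType) (H : hilbertType R).
Implicit Types (x y z w : H) (A X T S : H -> H) (C : R).
Local Open Scope complex_scope.

(** Polarization: the form being real at [x + y] gives the imaginary part of the identity, and at
    [x + 'i *: y] the real part. *)
Lemma selfadjoint_of_real A : linear A ->
  (forall x, complex.Im (inner (A x) x) = 0) -> is_adjoint A A.
Proof.
move=> Al h x y; rewrite (innerC x).
have := h (x + y); rewrite (linD Al) innerDl !innerDr => h1.
have := h (x + 'i *: y); rewrite (linD Al) innerDl !innerDr (linZ Al) !(innerZl, innerZr).
move: h1 (h x) (h y).
case: (inner (A x) x) => a1 a2; case: (inner (A y) y) => b1 b2.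
case: (inner (A x) y) => p q; case: (inner (A y) x) => s t /=.
move=> h1 h2 h3 h4; apply/eqP; rewrite eq_complex /=; apply/andP; split; apply/eqP; lra.
Qed.

Lemma selfadjoint_im A x : is_adjoint A A -> complex.Im (inner (A x) x) = 0.
Proof.
move=> h; have := innerC (A x) x; rewrite -h.
by case: (inner _ _) => a b /= [] /eqP; rewrite -addr_eq0 -mulr2n mulrn_eq0 => /eqP.
Qed.

Lemma positive_selfadjoint A : positive_operator A -> is_adjoint A A.
Proof.
move=> [[Al _] A0]; apply: selfadjoint_of_real => // x.
by have := A0 x; rewrite lecE /= => /andP[/eqP].
Qed.

Definition positive_contraction X := [/\ linear X, is_adjoint X X &
  forall x, 0 <= complex.Re (inner (X x) x) <= nrm x ^+ 2].

Lemma Re_inner_nrm x : complex.Re (inner x x) = nrm x ^+ 2.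
Proof. by rewrite inner_nrm. Qed.

Section PositiveContraction.
Variable X : H -> H.
Hypothesis pX : positive_contraction X.
Let Xl : linear X. Proof. by case: pX. Qed.
Let Xs : is_adjoint X X. Proof. by case: pX. Qed.
Let X01 x : 0 <= complex.Re (inner (X x) x) <= nrm x ^+ 2. Proof. by case: pX. Qed.

(** X - X^2 = (1 - X) X (1 - X) + X (1 - X) X is a sum of two positive operators. *)
Lemma pc_sqr_le x : nrm (X x) ^+ 2 <= complex.Re (inner (X x) x).
Proof.
rewrite -subr_ge0 -Re_inner_nrm -ReB -innerBr.
have -> : inner (X x) (x - X x) = inner (X (x - X x)) (x - X x) +
    (inner (X x) (X x) - inner (X (X x)) (X x)).
  rewrite (linB Xl) !innerBl !innerBr.
  rewrite (Xs (X x) x); ring.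
rewrite raddfD /= ReB addr_ge0 ?(andP (X01 _)).1// subr_ge0 Re_inner_nrm.
by case/andP: (X01 (X x)).
Qed.

Lemma pc_bounded : bounded_by X 1.
Proof.
split=> // x; rewrite mul1r -(@ler_pXn2r _ 2)// ?nnegrE ?nrm_ge0//.
by rewrite (le_trans (pc_sqr_le x))//; case/andP: (X01 x).
Qed.

Let a x n := complex.Re (inner (iter n X x) x).

Lemma pc_iter_adj m n x : inner (iter m X x) (iter n X x) = inner (iter (m + n) X x) x.
Proof.
elim: n m => [|n IH] m; first by rewrite addn0.
by rewrite /= -Xs -iterS IH addSnnS.
Qed.

(** By parity: <X^(2m) x, x> = |X^m x|^2, and <X^(2m+1) x, x> = <X y, y> with y = X^m x. The same
    splitting proves monotonicity in [pc_iter_leS]. *)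
Lemma pc_iter_ge0 x n : 0 <= a x n.
Proof.
rewrite /a -(odd_double_half n) -addnn addnA -pc_iter_adj; case: (odd n).
  by rewrite add1n iterS; case/andP: (X01 (iter n./2 X x)).
by rewrite add0n Re_inner_nrm sqr_ge0.
Qed.

Lemma pc_iter_leS x n : a x n.+1 <= a x n.
Proof.
rewrite /a -(odd_double_half n) -addnn addnA -addSn; case: (odd n).
  rewrite !add1n (addSnnS n./2.+1) -!pc_iter_adj iterS Re_inner_nrm.
  exact: pc_sqr_le.
rewrite !add0n -!pc_iter_adj Re_inner_nrm iterS.
by case/andP: (X01 (iter n./2 X x)).
Qed.

Lemma pc_iter_le x m n : (m <= n)%N -> a x n <= a x m.
Proof.
elim: n => [|n IH]; first by rewrite leqn0 => /eqP ->.
rewrite leq_eqVlt => /orP[/eqP ->//|]; rewrite ltnS => /IH; apply: le_trans.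
exact: pc_iter_leS.
Qed.

Lemma pc_iter_distE x m n :
  nrm (iter m X x - iter n X x) ^+ 2 = a x (m + m) + a x (n + n) - 2 * a x (m + n).
Proof. by rewrite nrm_sqrB -!Re_inner_nrm !pc_iter_adj. Qed.

(** The moments a_n = <X^n x, x> decrease to a limit l, and |X^m x - X^n x|^2 = a_(2m) + a_(2n) - 2
    a_(m+n). With the first two within e^2 / 2 of l and the last at least l, this is less than
    e^2. *)
Lemma pc_iter_cauchy x (e : R) : 0 < e -> exists N, forall n m, (N <= n)%N -> (N <= m)%N ->
  nrm (iter n X x - iter m X x) < e.
Proof.
move=> e0; have /cvg_ex[l al] : cvgn (a x).
  apply: nonincreasing_is_cvgn; first by move=> m n; exact: pc_iter_le.
  by exists 0 => _ [n _ <-]; exact: pc_iter_ge0.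
have al0 : (fun n => a x n - l) @ \oo --> (0 : R).
  by rewrite -(subrr l); apply: cvgB => //; exact: cvg_cst.
have lle n : l <= a x n.
  rewrite -(cvg_lim (@Rhausdorff R) al); apply: nonincreasing_cvgn_ge; last exact: cvgP al.
  by move=> m k; exact: pc_iter_le.
have e2 : 0 < e ^+ 2 / 2 by rewrite divr_gt0// exprn_gt0.
have [N hN] := cvg0_eventually al0 e2; exists N => n m Nn Nm.
rewrite -(@ltr_pXn2r _ 2)// ?nnegrE ?nrm_ge0 ?ltW// pc_iter_distE.
have := hN (n + n)%N (leq_trans Nn (leq_addr _ _)).
have := hN (m + m)%N (leq_trans Nm (leq_addr _ _)).
have := lle (n + m)%N; lra.
Qed.

Lemma pc_iter_diff_cvg0 x : (fun n => nrm (iter n X x - iter n.+1 X x)) @ \oo --> (0 : R).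
Proof.
apply: eventually_cvg0 => [n|e /(pc_iter_cauchy x)[N hN]]; first exact: nrm_ge0.
by exists N => n Nn; rewrite ltW// hN// (leq_trans Nn).
Qed.

(** The squared norm is a_0 + a_(2n) - 2 a_n, where a_(2n) <= a_n and a_n >= 0. It makes the
    approximants of the polar factor contractions. *)
Lemma pc_compl_iter_le x n : nrm (x - iter n X x) <= nrm x.
Proof.
rewrite -(@ler_pXn2r _ 2)// ?nnegrE ?nrm_ge0// (pc_iter_distE x 0 n).
have := pc_iter_ge0 x n; have := pc_iter_le x (leq_addr n n).
rewrite [a x (0 + 0)]Re_inner_nrm add0n; lra.
Qed.

End PositiveContraction.

(** Dividing by a bound [c] of [A] places [1 - A/c] between 0 and 1. The square root and the polar
    decomposition both iterate this operator. *)
Lemma positive_scale A : positive_operator A -> exists2 c : R, 0 < c &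
  positive_contraction (fun x => x - c^-1%:C *: A x).
Proof.
move=> pA; have [c c0 [Al Ac]] := bounded_byP (proj1 pA); exists c => //.
have As := positive_selfadjoint pA.
split => [d x y|x y|x].
- rewrite Al scalerBr scalerDr opprD !scalerA (mulrC d); exact: addrACA.
- by rewrite innerBl innerBr innerZl innerZr conjc_real As.
have A0 : 0 <= complex.Re (inner (A x) x).
  by have := (proj2 pA) x; rewrite lecE => /andP[].
have A1 : complex.Re (inner (A x) x) <= c * nrm x ^+ 2.
  rewrite (le_trans (ler_norm _))// (le_trans (ler_Re_nrm _))//.
  by rewrite (le_trans (cauchy_schwarz _ _))// expr2 mulrA ler_wpM2r ?nrm_ge0.
have E : complex.Re (inner (x - c^-1%:C *: A x) x) =
    nrm x ^+ 2 - c^-1 * complex.Re (inner (A x) x).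
  by rewrite innerBl ReB Re_inner_nrm innerZl; case: (inner (A x) x) => s t /=; rewrite mul0r subr0.
rewrite E; apply/andP; split.
  by rewrite subr_ge0 ler_pdivrMl.
by rewrite gerBl mulr_ge0// invr_ge0 ltW.
Qed.

End Positive.

Section SquareRoot.
Variables (R : realType) (H : hilbertType R).
Implicit Types (x y z w : H) (A T S : H -> H) (C : R).
Local Open Scope complex_scope.

Section Iteration.
Variable X : H -> H.
Hypothesis X1 : bounded_by X 1.

Fixpoint sqrt_iter n : H -> H :=
  if n is n.+1 then fun x => 2^-1%:C *: (X x + sqrt_iter n (sqrt_iter n x)) else fun=> 0.

(** The scalar majorant of [sqrt_iter]: the same recursion with 1 in place of [X]. It increases and
    stays below 1, and its increments bound those of the operator iteration. *)
Fixpoint sqrt_rate n : R := if n is n.+1 then 2^-1 * (1 + sqrt_rate n ^+ 2) else 0.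

Lemma sqrt_iterS n x :
  sqrt_iter n.+1 x = 2^-1%:C *: (X x + sqrt_iter n (sqrt_iter n x)).
Proof. by []. Qed.

Lemma sqrt_rateE n : sqrt_rate n.+1 = 2^-1 * (1 + sqrt_rate n ^+ 2).
Proof. by []. Qed.

Lemma sqrt_rate01 n : 0 <= sqrt_rate n <= 1.
Proof. by elim: n => [|n /andP[h0 h1]] /=; [lra|apply/andP; split; nra]. Qed.

Lemma sqrt_rateS n : sqrt_rate n <= sqrt_rate n.+1.
Proof. by have := sqrt_rate01 n => /andP[h0 h1] /=; have := sqr_ge0 (1 - sqrt_rate n); nra. Qed.

Lemma sqrt_iter_bounded n : bounded_by (sqrt_iter n) (sqrt_rate n).
Proof.
elim: n => [|n IH]; first exact: bounded_by0.
have /andP[r0 _] := sqrt_rate01 n.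
have := bounded_byZ 2^-1%:C (bounded_byD X1 (bounded_by_comp r0 IH IH)).
by rewrite nrm_real ger0_norm ?invr_ge0// -expr2.
Qed.

Lemma sqrt_iter_comm W n x : linear W -> (forall x, W (X x) = X (W x)) ->
  W (sqrt_iter n x) = sqrt_iter n (W x).
Proof.
move=> Wl WX; elim: n x => [|n IH] x /=; first by rewrite lin0.
by rewrite linZ// linD// WX !IH.
Qed.

Lemma sqrt_iter_commX n x : X (sqrt_iter n x) = sqrt_iter n (X x).
Proof. by apply: sqrt_iter_comm => //; case: X1. Qed.

Lemma sqrt_iterC m n x : sqrt_iter m (sqrt_iter n x) = sqrt_iter n (sqrt_iter m x).
Proof.
apply: sqrt_iter_comm; first by case: (sqrt_iter_bounded m).
by move=> y; rewrite sqrt_iter_commX.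
Qed.

(** The iterates commute, so with Y_n the n-th one, Y_(n+2) - Y_(n+1) = (Y_(n+1) + Y_n)(Y_(n+1) -
    Y_n) / 2. The increments of [sqrt_rate] factor in the same way. *)
Lemma sqrt_iter_step n : bounded_by (fun x => sqrt_iter n.+1 x - sqrt_iter n x)
  (sqrt_rate n.+1 - sqrt_rate n).
Proof.
elim: n => [|n IH].
  have := bounded_byZ 2^-1%:C X1; rewrite nrm_real ger0_norm ?invr_ge0//= => h.
  rewrite expr0n /= addr0 subr0 (_ : (fun x => _) = fun x => 2^-1%:C *: X x)//.
  by apply/funext => x; rewrite addr0 subr0.
have r0 m : 0 <= sqrt_rate m by case/andP: (sqrt_rate01 m).
have rs : 0 <= sqrt_rate n.+1 + sqrt_rate n by exact: addr_ge0.
have := bounded_byZ 2^-1%:C (bounded_by_comp rs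
  (bounded_byD (sqrt_iter_bounded n.+1) (sqrt_iter_bounded n)) IH).
rewrite nrm_real ger0_norm ?invr_ge0// mulrC -(mulrC (_ - _)) -subr_sqr => h.
have -> : sqrt_rate n.+2 - sqrt_rate n.+1 = (sqrt_rate n.+1 ^+ 2 - sqrt_rate n ^+ 2) * 2^-1.
  by rewrite (sqrt_rateE n.+1) [in X in _ - X]sqrt_rateE; field.
congr (bounded_by _ _) : h; apply/funext => x.
have L m := proj1 (sqrt_iter_bounded m).
transitivity (2^-1%:C *: (sqrt_iter n.+1 (sqrt_iter n.+1 x - sqrt_iter n x) +
  sqrt_iter n (sqrt_iter n.+1 x - sqrt_iter n x))) => //.
rewrite !(linB (L _)) (sqrt_iterC n n.+1) addrA subrK (sqrt_iterS n.+1) [X in _ = _ - X]sqrt_iterS.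
move: (sqrt_iter n.+1 (sqrt_iter n.+1 x)) (sqrt_iter n (sqrt_iter n x)) => a d.
by rewrite -scalerBr opprD addrACA subrr add0r.
Qed.

Lemma sqrt_iter_dist m n : (n <= m)%N ->
  bounded_by (fun x => sqrt_iter m x - sqrt_iter n x) (sqrt_rate m - sqrt_rate n).
Proof.
elim: m => [|m IH]; first by rewrite leqn0 => /eqP ->; rewrite subrr; under eq_fun do rewrite subrr; exact: bounded_by0.
rewrite leq_eqVlt => /orP[/eqP ->|]; first by rewrite subrr; under eq_fun do rewrite subrr; exact: bounded_by0.
rewrite ltnS => /IH h; have := bounded_byD (sqrt_iter_step m) h.
rewrite addrA subrK; congr (bounded_by _ _); apply/funext => x.
by rewrite addrA subrK.
Qed.

Lemma sqrt_rate_cvg : cvgn sqrt_rate.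
Proof.
apply: nondecreasing_is_cvgn; first by apply/nondecreasing_seqP => n; exact: sqrt_rateS.
by exists 1 => _ [n _ <-]; case/andP: (sqrt_rate01 n).
Qed.

Lemma sqrt_iter_cvg x : cvgn (sqrt_iter ^~ x).
Proof.
have /cvg_ex[l rl] := sqrt_rate_cvg.
have mono : {homo sqrt_rate : n m / (n <= m)%N >-> n <= m}.
  by apply/nondecreasing_seqP => n; exact: sqrt_rateS.
have rll n : sqrt_rate n <= l.
  by rewrite -(cvg_lim (@Rhausdorff R) rl); apply: nondecreasing_cvgn_le => //; exact: cvgP rl.
have rl0 : (fun n => (l - sqrt_rate n) * nrm x) @ \oo --> (0 : R).
  rewrite -(mul0r (nrm x)) -(subrr l); apply: cvgMl; apply: cvgB => //; exact: cvg_cst.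
apply: nrm_cauchy_cvg => e e0; have [N hN] := cvg0_eventually rl0 e0.
have {}hN n m : (N <= n)%N -> (n <= m)%N -> nrm (sqrt_iter m x - sqrt_iter n x) < e.
  move=> Nn nm; apply: le_lt_trans (hN _ Nn).
  by rewrite (le_trans (proj2 (sqrt_iter_dist nm) x))// ler_wpM2r ?nrm_ge0// lerD2r.
exists N => n m Nn Nm; have [nm|/ltnW mn] := leqP n m; last exact: hN.
by rewrite nrmBC; exact: hN.
Qed.

End Iteration.

Lemma sqrt_iter_adj X n : is_adjoint X X -> is_adjoint (sqrt_iter X n) (sqrt_iter X n).
Proof.
move=> Xs; elim: n => [|n IH] x y; first by rewrite inner0l inner0r.
by rewrite !sqrt_iterS innerZl innerZr conjc_real innerDl innerDr Xs !IH.
Qed.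

(* The limit Z of the iteration solves Z = (X + Z^2) / 2, that is (1 - Z)^2 = 1 - X. *)
Lemma contraction_sqrt_compl X : bounded_by X 1 -> is_adjoint X X ->
  exists Z, [/\ bounded_by Z 1, is_adjoint Z Z & forall x, Z x + Z x = X x + Z (Z x)].
Proof.
move=> X1 Xs; pose Z x := limn (sqrt_iter X ^~ x).
have ZE x : sqrt_iter X ^~ x @ \oo --> Z x by exact: sqrt_iter_cvg.
have bn n : bounded_by (sqrt_iter X n) 1.
  by apply: bounded_byW (sqrt_iter_bounded X1 n); case/andP: (sqrt_rate01 n).
have Z1 : bounded_by Z 1 := bounded_by_lim bn ZE.
exists Z; split => //.
  by move=> x y; apply: inner_cvg_eq (ZE x) (ZE y) _ => n; exact: sqrt_iter_adj.
move=> x; apply: nrm_le0_eq.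
have /cvg_nrmP h1 := ZE x; have /cvg_nrmP h2 := ZE (Z x).
have h3 : (fun n => nrm (sqrt_iter X n.+1 x - Z x)) @ \oo --> (0 : R).
  by rewrite (cvg_shiftS (fun n => nrm (sqrt_iter X n x - Z x))); exact: h1.
apply: (@cvg0_le _ _ 1 (fun n => 2 * nrm (sqrt_iter X n.+1 x - Z x) +
  (nrm (sqrt_iter X n x - Z x) + nrm (sqrt_iter X n (Z x) - Z (Z x))))); last first.
  rewrite -[X in _ --> X]addr0 -{1}(mulr0 2) -[in X in _ + X](addr0 0).
  by apply: cvgD; [exact: cvgMr|exact: cvgD].
move=> n; rewrite mul1r.
have -> : Z x + Z x - (X x + Z (Z x)) =
   (sqrt_iter X n (sqrt_iter X n x - Z x) + (sqrt_iter X n (Z x) - Z (Z x))) -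
   2%:R%:C *: (sqrt_iter X n.+1 x - Z x).
  rewrite sqrt_iterS scalerBr scalerA -rmorphM /= divff ?pnatr_eq0// scale1r.
  rewrite (linB (proj1 (bn n))) rmorph_nat scaler_nat mulr2n.
  move: (sqrt_iter X n (sqrt_iter X n x)) (sqrt_iter X n (Z x)) => a b.
  rewrite [a - b + _]addrA subrK opprB [RHS]addrC -[RHS]addrA; congr (_ + _).
  by rewrite !opprD addrA subrK.
rewrite (le_trans (ler_nrmB _ _))// addrC lerD//.
  by rewrite nrmZ nrm_real normr_nat.
rewrite (le_trans (ler_nrmD _ _))// lerD//.
by rewrite (le_trans (proj2 (bn n) _))// mul1r.
Qed.

(** With [X = 1 - A/c] and [Z] solving (1 - Z)^2 = 1 - X, the operator sqrt(c) (1 - Z) squares to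
    [A]; it is positive because [Z] is a selfadjoint contraction. *)
Lemma positive_sqrt A : positive_operator A ->
  exists2 B, positive_operator B & forall x, B (B x) = A x.
Proof.
move=> pA; have [c c0 pX] := positive_scale pA.
set X := (X in positive_contraction X) in pX.
have Xs : is_adjoint X X by case: pX.
have [Z [Z1 Zs ZE]] := contraction_sqrt_compl (pc_bounded pX) Xs.
pose s := Num.sqrt c; pose W x := x - Z x; pose B x := s%:C *: W x.
have bW : bounded_by W (1 + 1) := bounded_byB (@bounded_by_id R H) Z1.
have bB := bounded_byZ s%:C bW.
exists B; first split; first exact: bounded_by_operator bB.
  move=> x; rewrite /B innerZl mulr_ge0//; first by rewrite -[0]/(0%:C) lecR sqrtr_ge0.
  have Z0 := selfadjoint_im x Zs.
  have Zx : complex.Re (inner (Z x) x) <= nrm x ^+ 2.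
    rewrite (le_trans (ler_norm _))// (le_trans (ler_Re_nrm _))//.
    rewrite (le_trans (cauchy_schwarz _ _))// expr2 ler_wpM2r ?nrm_ge0//.
    by rewrite (le_trans (proj2 Z1 x))// mul1r.
  by rewrite /W innerBl inner_nrm lecE /= ImB ReB /= Z0 subrr eqxx /= subr_ge0.
move=> x; rewrite /B (linZ (proj1 bW)) scalerA -rmorphM /= -expr2 sqr_sqrtr ?ltW//.
have -> : W (W x) = c^-1%:C *: A x.
  have -> : c^-1%:C *: A x = x - X x by rewrite /X opprB addrC subrK.
  rewrite /W (linB (proj1 Z1)) opprB addrACA -opprD ZE opprD addrACA subrr.
  exact: addr0.
by rewrite scalerA -rmorphM /= mulfV ?gt_eqF// scale1r.
Qed.

End SquareRoot.

Section Polar.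
Variables (R : realType) (H : hilbertType R).
Implicit Types (x y z w : H) (A T S : H -> H) (C : R).
Local Open Scope complex_scope.

(* The partial isometry is the strong limit of [c^-1 T (1 + X + ... + X^(n-1))]
   with [X = 1 - A / c], since [(A / c) (1 + X + ... + X^(n-1)) = 1 - X^n]. *)
Lemma polar_decomposition T A : bounded_operator T -> is_absolute_value T A ->
  exists U, [/\ bounded_by U 1, forall x, U (A x) = T x &
    forall x y, inner (T x) (U y) = inner (A x) y].
Proof.
move=> bT [pA [S [bS TS] AA]].
have [C C0 [Tl TC]] := bounded_byP bT.
have TA x y : inner (T x) (T y) = inner (A x) (A y).
  rewrite TS [RHS](positive_selfadjoint pA).
  by have := congr1 (fun f => f y) AA => /= ->.
have nTA x : nrm (T x) = nrm (A x).
  apply/eqP; rewrite -(@eqrXn2 _ 2)// ?nrm_ge0//; apply/eqP/complexI.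
  by rewrite -!inner_nrm TA.
have Al : linear A by case: pA => -[].
have [c c0 pX] := positive_scale pA; set X := (X in positive_contraction X) in pX.
have Xl : linear X by case: pX.
have XE x : A x = c%:C *: (x - X x).
  by rewrite /X opprB addrC subrK scalerA -rmorphM /= mulfV ?gt_eqF// scale1r.
pose G n x := \sum_(0 <= j < n) iter j X x.
have GS n x : G n.+1 x = G n x + iter n X x by rewrite /G big_nat_recr.
have Gl n : linear (G n).
  move=> d x y; rewrite /G scaler_sumr -big_split /=; apply: eq_bigr => j _.
  by elim: j => //= j ->; rewrite Xl.
have AG n x : c^-1%:C *: A (G n x) = x - iter n X x.
  elim: n => [|n IH]; first by rewrite /G big_geq// lin0// scaler0 subrr.
  rewrite GS (linD Al) scalerDr IH [A (iter n X x)]XE scalerA -rmorphM /= mulVf ?gt_eqF//.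
  by rewrite scale1r addrA subrK.
pose V n x := c^-1%:C *: T (G n x).
(* Since |T z| = |A z|, distances between the [V n x] are distances on the orbit of [x] under [X],
   which is Cauchy. *)
have nV n m x : nrm (V n x - V m x) = nrm (iter m X x - iter n X x).
  rewrite /V -scalerBr -(linB Tl) nrmZ nTA -nrmZ (linB Al) scalerBr !AG.
  by rewrite opprB addrCA addrAC subrr add0r addrC.
have V0 n x : nrm (V n x) = nrm (x - iter n X x).
  by rewrite /V nrmZ nTA -nrmZ AG.
have Vb n : bounded_by (V n) 1.
  split=> [d x y|x]; first by rewrite /V Gl Tl scalerDr !scalerA (mulrC d).
  by rewrite V0 mul1r; exact: pc_compl_iter_le.
pose U x := limn (V ^~ x).
have VU x : V ^~ x @ \oo --> U x.
  apply: nrm_cauchy_cvg => e /(pc_iter_cauchy pX x)[N hN]; exists N => n m Nn Nm.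
  by rewrite nV hN.
(* [X] fixes the kernel of [A], so X^n x need not tend to 0; but A X^n x = c (X^n x - X^(n+1) x)
   does. *)
have AX0 x : (fun n => nrm (A (iter n X x))) @ \oo --> (0 : R).
  rewrite (_ : (fun n => _) = fun n => c * nrm (iter n X x - iter n.+1 X x)).
    by rewrite -(mulr0 c); apply: cvgMr; exact: pc_iter_diff_cvg0.
  by apply/funext => n; rewrite XE nrmZ nrm_real gtr0_norm.
have Xadj n x y : inner (iter n X x) y = inner x (iter n X y).
  have Xs : is_adjoint X X by case: pX.
  by elim: n x y => // n IH x y; rewrite iterS Xs IH -iterSr.
have AXc n x : A (iter n X x) = iter n X (A x).
  elim: n x => // n IH x; rewrite !iterS -IH [X (A _)]/X.
  by rewrite [X (iter n X x)]/X (linB Al) (linZ Al).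
exists U; split; first exact: bounded_by_lim Vb VU.
- move=> x; apply: nrm_le0_eq; have /cvg_nrmP h := VU (A x).
  apply: (@cvg0_le _ _ 1 (fun n => nrm (V n (A x) - U (A x)) + nrm (A (iter n X x)))); last first.
    by rewrite -[X in _ --> X]addr0; apply: cvgD.
  move=> n; rewrite mul1r.
  have -> : U (A x) - T x = (V n (A x) - T x) - (V n (A x) - U (A x)).
    by rewrite opprB [RHS]addrC addrA subrK.
  rewrite (le_trans (ler_nrmB _ _))// addrC lerD//.
  have -> : V n (A x) = T (x - iter n X x).
    rewrite /V -AG -(linZ Tl); congr (T (_ *: _)).
    rewrite /G (lin_sum Al); apply: eq_bigr => j _; exact/esym/AXc.
  by rewrite (linB Tl) addrAC subrr add0r nrmN nTA.
- move=> x y; apply/eqP; rewrite -subr_eq0 -nrm_eq0 eq_le nrm_ge0 andbT.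
  have /cvg_nrmP h := VU y.
  apply: (@cvg0_le _ _ 1 (fun n => nrm (T x) * nrm (V n y - U y) +
      nrm (A (iter n X x)) * nrm y)); last first.
    rewrite -[X in _ --> X]addr0 -{1}(mulr0 (nrm (T x))) -[in X in _ + X](mul0r (nrm y)).
    by apply: cvgD; [exact: cvgMr|exact: cvgMl].
  move=> n; rewrite mul1r.
  have E : inner (T x) (V n y) = inner (A x) y - inner (A (iter n X x)) y.
    rewrite /V innerZr conjc_real TA AXc Xadj -innerBr -AG innerZr conjc_real.
    by [].
  have -> : inner (T x) (U y) - inner (A x) y =
      inner (T x) (U y - V n y) - inner (A (iter n X x)) y.
    by rewrite innerBr E; ring.
  rewrite (le_trans (ler_nrmB _ _))// lerD ?cauchy_schwarz// nrmBC.
  exact: cauchy_schwarz.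
Qed.

End Polar.

(** * Trace norm and trace *)

Section Tannery.
Variable R : realType.
Local Open Scope complex_scope.

Lemma cvg_sum_nat0 (F : nat -> nat -> R) m : (forall j, F ^~ j @ \oo --> (0 : R)) ->
  (fun n => \sum_(0 <= j < m) F n j) @ \oo --> (0 : R).
Proof.
move=> h; elim: m => [|m IH].
  by under eq_fun do rewrite big_geq//; exact: cvg_cst.
under eq_fun do rewrite big_nat_recr//=.
by have := cvgD IH (h m); rewrite addr0; apply.
Qed.

(** Dominated convergence for series. It exchanges the sum over a basis with the rank-one expansion
    in [trace_class_trace]. *)
Lemma tannery (s : nat -> nat -> R[i]) (t : nat -> R[i]) (b : nat -> R) (M : R)
    (S : nat -> R[i]) (c : R[i]) :
  (forall n j, nrm (s n j) <= b j) -> (forall j, nrm (t j) <= b j) ->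
  (forall n, \sum_(0 <= j < n) b j <= M) ->
  (forall j, s ^~ j @ \oo --> t j) ->
  (forall n, series (s n) @ \oo --> S n) -> series t @ \oo --> c ->
  S @ \oo --> c.
Proof.
move=> sb tb bM st sS tc; apply/cvg_complex_nrmP.
have b0 j : 0 <= b j by exact: le_trans (nrm_ge0 _) (tb j).
apply: eventually_cvg0 => [n|e e0]; first exact: nrm_ge0.
have e4 : 0 < e / 4 by rewrite divr_gt0.
have [J hJ] := nneg_series_tail b0 (nneg_series_cvg b0 bM) e4.
have /cvg0_eventually/(_ e4)[N hN] :
    (fun n => \sum_(0 <= j < J) nrm (s n j - t j)) @ \oo --> (0 : R).
  apply: (@cvg_sum_nat0 (fun n j => nrm (s n j - t j))) => j.
  by have /cvg_complex_nrmP := st j.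
exists N => n Nn.
have /cvg_complex_nrmP hS := sS n; have /cvg_complex_nrmP hc := tc.
rewrite -subr_le0.
apply: (@cvg0_le _ _ 1 (fun m => nrm (series (s n) (m + J)%N - S n) +
    nrm (series t (m + J)%N - c))); last first.
  rewrite -[X in _ --> X]addr0; apply: cvgD.
    by rewrite (cvg_shiftn J (fun m => nrm (series (s n) m - S n))).
  by rewrite (cvg_shiftn J (fun m => nrm (series t m - c))).
move=> m; rewrite mul1r lerBlDr.
have -> : S n - c = (series (s n) (m + J)%N - series t (m + J)%N) +
   ((series t (m + J)%N - c) - (series (s n) (m + J)%N - S n)) by ring.
rewrite (le_trans (ler_nrmD _ _))// addrC lerD//.
  by rewrite (le_trans (ler_nrmB _ _))// addrC.
rewrite /series /= -sumrB (big_cat_nat (leq0n J) (leq_addl m J))/=.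
rewrite (le_trans (ler_nrmD _ _))//.
have h1 := hN n Nn; have h2 := hJ J (m + J)%N (leqnn J).
have h3 := ler_nrm_sum (index_iota 0 J) xpredT (fun j => s n j - t j).
have h4 := ler_nrm_sum (index_iota J (m + J)) xpredT (fun j => s n j - t j).
have h5 : \sum_(J <= j < m + J) nrm (s n j - t j) <= \sum_(J <= j < m + J) (b j + b j).
  by apply: ler_sum => j _; rewrite (le_trans (ler_nrmB _ _))// lerD.
rewrite big_split /= in h5; lra.
Qed.

End Tannery.

Section TraceNorm.
Variables (R : realType) (H : hilbertType R).
Implicit Types (x y : nat -> H) (V T S : H -> H) (M C D : R) (e : nat -> H).
Local Open Scope complex_scope.

(** Equivalently, z |-> (<z, x_k>)_k is a contraction into C^n. Contractions do not preserve
    orthonormality, hence this weaker condition. *)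
Definition bessel n x := forall z : H,
  \sum_(0 <= k < n) nrm (inner z (x k)) ^+ 2 <= nrm z ^+ 2.

(* The least such M is the trace norm of V. *)
Definition tn_le V M := forall n x y, bessel n x -> bessel n y ->
  \sum_(0 <= k < n) nrm (inner (V (x k)) (y k)) <= M.

Lemma bessel_image T S n x : is_adjoint T S -> bounded_by S 1 -> bessel n x ->
  bessel n (T \o x).
Proof.
move=> TS [_ S1] bx z; under eq_bigr do rewrite /= -(adjoint_sym TS).
rewrite (le_trans (bx _))// ler_pXn2r ?nnegrE ?nrm_ge0//.
by rewrite (le_trans (S1 _))// mul1r.
Qed.

Lemma tn_leW V M M' : M <= M' -> tn_le V M -> tn_le V M'.
Proof. by move=> MM h n x y bx b_y; rewrite (le_trans (h _ _ _ bx b_y)). Qed.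

Lemma tn_le0 : tn_le (fun=> 0) 0.
Proof. by move=> n x y _ _; rewrite big1// => k _; rewrite inner0l nrm0. Qed.

Lemma tn_leD V T M M' : tn_le V M -> tn_le T M' -> tn_le (fun z => V z + T z) (M + M').
Proof.
move=> h h' n x y bx b_y; rewrite (le_trans _ (lerD (h _ _ _ bx b_y) (h' _ _ _ bx b_y)))//.
by rewrite -big_split; apply: ler_sum => k _; rewrite innerDl ler_nrmD.
Qed.

Lemma tn_leZ V M (c : R[i]) : tn_le V M -> tn_le (fun z => c *: V z) (nrm c * M).
Proof.
move=> h n x y bx b_y; under eq_bigr do rewrite innerZl nrmM.
by rewrite -mulr_sumr ler_wpM2l ?nrm_ge0// h.
Qed.

Lemma tn_le_sum (F : nat -> H -> H) (b : nat -> R) m n :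
  (forall k, tn_le (F k) (b k)) ->
  tn_le (fun z => \sum_(m <= k < n) F k z) (\sum_(m <= k < n) b k).
Proof.
move=> h; elim: n => [|n IH].
  by under eq_fun do rewrite big_geq//; rewrite big_geq//; exact: tn_le0.
have [mn|nm] := leqP m n; last first.
  by under eq_fun do rewrite big_geq//; rewrite big_geq//; exact: tn_le0.
under eq_fun do rewrite big_nat_recr//=; rewrite big_nat_recr//=.
exact: tn_leD IH (h n).
Qed.

Lemma tn_le_compl V M T S : is_adjoint T S -> bounded_by T 1 -> tn_le V M -> tn_le (T \o V) M.
Proof.
move=> TS T1 h n x y bx b_y.
under eq_bigr do rewrite /= TS.
by apply: h => //; apply: bessel_image b_y; [exact: adjoint_sym TS|].
Qed.

Lemma tn_le_compr V M T S : is_adjoint T S -> bounded_by S 1 -> tn_le V M -> tn_le (V \o T) M.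
Proof. by move=> TS T1 h n x y bx b_y; apply: h => //; exact: bessel_image bx. Qed.

Lemma tn_le_lim (F : nat -> H -> H) G M : (forall n, tn_le (F n) M) ->
  (forall z, F ^~ z @ \oo --> G z) -> tn_le G M.
Proof.
move=> h FG m x y bx b_y; rewrite -subr_le0.
apply: (@cvg0_le _ _ 1 (fun n => \sum_(0 <= k < m) nrm (F n (x k) - G (x k)) * nrm (y k))); last first.
  apply: cvg_sum_nat0 => k; rewrite -(mul0r (nrm (y k))); apply: cvgMl.
  by have /cvg_nrmP := FG (x k).
move=> n; rewrite mul1r lerBlDr (le_trans _ (lerD (lexx _) (h n m x y bx b_y)))//.
rewrite -big_split; apply: ler_sum => k _.
have -> : inner (G (x k)) (y k) = inner (F n (x k)) (y k) - inner (F n (x k) - G (x k)) (y k).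
  by rewrite innerBl subKr.
by rewrite (le_trans (ler_nrmB _ _))// addrC lerD// cauchy_schwarz.
Qed.

(** Write V = U A = (U B) B with [B] a square root of [A], and expand B z in the basis [e]: this
    gives f_j = B e_j and g_j = U B e_j. Both have squared norms bounded by |B e_j|^2 = <A e_j,
    e_j>, whose sum is finite. *)
Lemma trace_class_nuclear V : trace_class V -> exists f g M, [/\
  forall z, series (fun j => inner z (f j) *: g j) @ \oo --> V z,
  forall n, \sum_(0 <= j < n) nrm (f j) ^+ 2 <= M &
  forall n, \sum_(0 <= j < n) nrm (g j) ^+ 2 <= M].
Proof.
move=> [bV [A [e [VA eONB sA]]]].
have [U [U1 UA _]] := polar_decomposition bV VA.
have [B pB BB] := positive_sqrt (proj1 VA).
have Bs := positive_selfadjoint pB.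
have [C C0 bB] := bounded_byP (proj1 pB).
have nB k : nrm (B (e k)) ^+ 2 = complex.Re (inner (A (e k)) (e k)).
  by rewrite -BB Bs Re_inner_nrm.
set s := (X in (X < +oo)%E) in sA.
have sM n : \sum_(0 <= k < n) nrm (B (e k)) ^+ 2 <= fine s.
  rewrite -lee_fin fineK; last first.
    rewrite ge0_fin_numE//; apply: nneseries_ge0 => k _ _.
    by rewrite lee_fin -nB sqr_ge0.
  rewrite -sumEFin; under eq_bigr do rewrite nB.
  by apply: nneseries_lim_ge => k _ _; rewrite lee_fin -nB sqr_ge0.
exists (B \o e), (U \o B \o e), (fine s); split=> //.
- move=> z; have bUB := bounded_by_comp ler01 U1 bB.
  have [_ /(_ (B z)) ez] := eONB; have h := bounded_by_cvg bUB ez.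
  rewrite /= BB UA in h.
  rewrite (_ : series _ = (U \o B) \o series (fun k => inner (B z) (e k) *: e k)).
    exact: h.
  apply/funext => n.
  transitivity ((U \o B) (\sum_(0 <= k < n) inner (B z) (e k) *: e k)) => //.
  rewrite /series (lin_sum (proj1 bUB)); apply: eq_bigr => k _.
  by rewrite (linZ (proj1 bUB)) Bs.
- move=> n; rewrite (le_trans _ (sM n))//; apply: ler_sum => k _ /=.
  rewrite ler_pXn2r ?nnegrE ?nrm_ge0//.
  by rewrite (le_trans (proj2 U1 _))// mul1r.
Qed.

Lemma half_sqr_bound (a b : R) : a * b <= (a ^+ 2 + b ^+ 2) / 2.
Proof. by have := sqr_ge0 (a - b); lra. Qed.

(** For a partial sum over [j], split each product by a b <= (a^2 + b^2) / 2, sum over [k] first,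
    and apply the Bessel inequality to f_j and g_j. The bound passes to the pointwise limit. *)
Lemma nuclear_tn_le V (f g : nat -> H) M :
  (forall z, series (fun j => inner z (f j) *: g j) @ \oo --> V z) ->
  (forall n, \sum_(0 <= j < n) nrm (f j) ^+ 2 <= M) ->
  (forall n, \sum_(0 <= j < n) nrm (g j) ^+ 2 <= M) -> tn_le V M.
Proof.
move=> hV hf hg; apply: tn_le_lim hV => J n x y bx b_y.
pose h j := \sum_(0 <= k < n) nrm (inner (inner (x k) (f j) *: g j) (y k)).
apply: (@le_trans _ _ (\sum_(0 <= j < J) h j)).
  rewrite /h exchange_big /=; apply: ler_sum => k _.
  by rewrite /series /= inner_suml ler_nrm_sum.
apply: (@le_trans _ _ (\sum_(0 <= j < J) (nrm (f j) ^+ 2 + nrm (g j) ^+ 2) / 2)).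
  apply: ler_sum => j _; apply: (@le_trans _ _ (\sum_(0 <= k < n)
     (nrm (inner (f j) (x k)) ^+ 2 + nrm (inner (g j) (y k)) ^+ 2) / 2)).
    by apply: ler_sum => k _; rewrite innerZl nrmM (nrm_innerC (x k)) half_sqr_bound.
  by rewrite -mulr_suml ler_wpM2r ?invr_ge0// big_split /= lerD.
rewrite -mulr_suml big_split /=; have := hf J; have := hg J; lra.
Qed.

Lemma trace_class_tn_le V : trace_class V -> exists M, tn_le V M.
Proof.
by move=> /trace_class_nuclear[f [g [M [h1 h2 h3]]]]; exists M; exact: nuclear_tn_le h1 h2 h3.
Qed.

(** The right pair of test families is [e] and [U \o e]: <V e_k, U e_k> = <A e_k, e_k>, so the test
    bound controls the partial sums that define trace class. *)
Lemma tn_le_trace_class V M e : orthonormal_basis e -> bounded_operator V ->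
  tn_le V M -> trace_class V.
Proof.
move=> eONB bV VM; split => //.
have [C C0 VC] := bounded_byP bV.
have [S VS] := adjoint_exists eONB (ltW C0) VC.
have bS := adjoint_bounded (ltW C0) VC VS.
have [A pA AA] : exists2 A, positive_operator A & forall z, A (A z) = (S \o V) z.
  apply: positive_sqrt; split.
    by apply: bounded_by_operator (bounded_by_comp (ltW C0) bS VC).
  move=> z /=; rewrite (adjoint_sym VS) inner_nrm -[0]/(0%:C) lecR.
  exact: sqr_ge0.
have VA : is_absolute_value V A.
  split => //; exists S; first by split => //; exact: bounded_by_operator bS.
  exact/funext.
exists A, e; split => //.
have [U [U1 UA UV]] := polar_decomposition bV VA.
have [W UW] := adjoint_exists eONB ler01 U1.
have W1 := adjoint_bounded ler01 U1 UW.
have A0 k : 0 <= complex.Re (inner (A (e k)) (e k)).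
  by have := (proj2 pA) (e k); rewrite lecE => /andP[].
have be n : bessel n e by move=> z; exact: bessel_onb.
apply: (@le_lt_trans _ _ M%:E); last exact: ltry.
apply: lime_le.
  by apply: is_cvg_nneseries => k _ _; rewrite lee_fin.
near=> n; rewrite sumEFin lee_fin (le_trans _ (VM n e (U \o e) _ _))//; last first.
  exact: bessel_image UW W1 (be n).
apply: ler_sum => k _; rewrite /= UV.
exact: le_trans (ler_norm _) (ler_Re_nrm _).
Unshelve. all: by end_near. Qed.

Lemma nrm_cvg_le (u : nat -> R[i]) (c : R[i]) M : u @ \oo --> c ->
  (forall n, nrm (u n) <= M) -> nrm c <= M.
Proof.
move=> /cvg_complex_nrmP uc uM; rewrite -subr_le0; apply: (@cvg0_le _ _ 1 _ _ uc) => n.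
rewrite mul1r lerBlDr -{1}(subKr (u n) c) (le_trans (ler_nrmB _ _))// addrC lerD// uM.
Qed.

(** The value is the sum of <g_j, f_j>, read off the rank-one expansion and thus independent of the
    basis. For a basis [e], the n-th partial trace is the sum over [j] of [s n j], which tends to
    <g_j, f_j> by Parseval and is dominated through Bessel. *)
Lemma trace_class_trace V : trace_class V -> exists c, is_trace V c.
Proof.
move=> tV; have [f [g [M [hV hf hg]]]] := trace_class_nuclear tV.
pose b j := (nrm (f j) ^+ 2 + nrm (g j) ^+ 2) / 2.
have b0 j : 0 <= b j by rewrite divr_ge0 ?addr_ge0 ?sqr_ge0.
have bM n : \sum_(0 <= j < n) b j <= M.
  by rewrite -mulr_suml big_split /=; have := hf n; have := hg n; lra.
have tb j : nrm (inner (g j) (f j)) <= b j.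
  by rewrite (le_trans (cauchy_schwarz _ _))// mulrC half_sqr_bound.
have [c tc] := complex_series_cvg tb bM.
exists c; split => // e eONB.
pose s n j := \sum_(0 <= k < n) inner (g j) (e k) * inner (e k) (f j).
refine (@tannery _ s _ b M (series (fun k => inner (V (e k)) (e k))) c _ tb bM _ _ tc).
- move=> n j; rewrite (le_trans (ler_nrm_sum _ _ _))//.
  apply: (@le_trans _ _ (\sum_(0 <= k < n)
     (nrm (inner (f j) (e k)) ^+ 2 + nrm (inner (g j) (e k)) ^+ 2) / 2)).
    apply: ler_sum => k _; rewrite nrmM (nrm_innerC (e k)) addrC.
    exact: half_sqr_bound.
  by rewrite -mulr_suml ler_wpM2r ?invr_ge0// big_split /= lerD// bessel_onb.
- by move=> j; exact: parseval_inner.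
- move=> n; rewrite [X in _ --> X](_ : _ = \sum_(0 <= k < n) inner (V (e k)) (e k)); last by [].
  elim: n => [|n IH].
    rewrite (big_geq (leqnn 0)) (_ : series _ = fun=> 0); first exact: cvg_cst.
    apply/funext => m; rewrite /series /= big1// => j _.
    by rewrite /s big_geq.
  rewrite (big_nat_recr _ _ _ (leq0n n)).
  rewrite (_ : series (s n.+1) = fun m => series (s n) m +
     inner (series (fun j => inner (e n) (f j) *: g j) m) (e n)); last first.
    apply/funext => m; rewrite /series /= inner_suml -big_split /=.
    by apply: eq_bigr => j _; rewrite /s big_nat_recr//= innerZl mulrC.
  have /cvg_nrmP h := hV (e n).
  apply: (cvg_complexD IH).
  apply/cvg_complex_nrmP; apply: (@squeeze_cvgr _ _ _ _ (fun=> 0)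
    (fun m => nrm (series (fun j => inner (e n) (f j) *: g j) m - V (e n)) * nrm (e n))).
  + by near=> m; rewrite nrm_ge0/= -innerBl cauchy_schwarz.
  + exact: cvg_cst.
  + by rewrite -(mul0r (nrm (e n))); exact: cvgMl.
Unshelve. all: by end_near. Qed.

Lemma is_trace_nrm_le V M e c : orthonormal_basis e -> tn_le V M -> is_trace V c ->
  nrm c <= M.
Proof.
move=> eONB VM [_ /(_ _ eONB) h]; apply: nrm_cvg_le h _ => n.
have be m : bessel m e by move=> z; exact: bessel_onb.
by rewrite (le_trans (ler_nrm_sum _ _ _))// (VM n e e).
Qed.

Lemma is_trace_unique V e c d : orthonormal_basis e -> is_trace V c -> is_trace V d -> c = d.
Proof.
move=> eONB [_ /(_ _ eONB) hc] [_ /(_ _ eONB) hd].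
exact: cvg_complex_unique hc hd.
Qed.

End TraceNorm.

(** * Power series of contractions *)

Lemma eq_cvgn (T : topologicalType) (u v : nat -> T) (l : T) :
  u =1 v -> u @ \oo --> l -> v @ \oo --> l.
Proof. by move=> /funext ->. Qed.

Section ClassG.
Variable R : realType.
Implicit Types (a : nat -> R[i]).
Local Open Scope complex_scope.

Lemma class_G_bound a : class_G a ->
  exists M, forall n, \sum_(0 <= k < n) nrm (k%:R * a k) <= M.
Proof.
move=> /cvg_ex[l al]; exists (complex.Re l) => n.
apply: (@nneg_series_le _ (fun k => nrm (k%:R * a k))); first by move=> k; exact: nrm_ge0.
apply: eq_cvgn (cvg_Re al) => m.
by rewrite /series /= raddf_sum.
Qed.

Lemma class_G_abs_bound a : class_G a ->
  exists M, forall n, \sum_(0 <= k < n) nrm (a k) <= M.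
Proof.
move=> /class_G_bound[M aM]; exists (nrm (a 0%N) + M) => n.
apply: (@le_trans _ _ (\sum_(0 <= k < n.+1) nrm (a k))).
  by rewrite big_nat_recr//= lerDl nrm_ge0.
rewrite big_nat_recl// lerD2l; apply: le_trans (aM n.+1).
rewrite [leRHS]big_nat_recl// mul0r nrm0 add0r; apply: ler_sum => k _.
by rewrite nrm_natl ler_peMl ?nrm_ge0// ler1n.
Qed.

Lemma finite_class_G a n : (forall k, (n <= k)%N -> a k = 0) -> class_G a.
Proof.
move=> a0; apply/cvg_ex.
exists (series (fun k => `|k%:R * a k|) n).
apply/cvg_complex_nrmP/cvgrPdist_lt => e e0; exists n => // m /= nm.
rewrite /series /= (big_cat_nat (leq0n n) nm)/= addrAC subrr add0r.
rewrite add0r big_nat big1 ?nrm0 ?oppr0 ?normr0//.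
by move=> k /andP[nk _]; rewrite a0// mulr0 normr0.
Qed.

Lemma delta_class_G n : class_G (fun k => (k == n)%:R : R[i]).
Proof. by apply: (@finite_class_G _ n.+1) => k nk; rewrite gtn_eqF. Qed.

End ClassG.

Section OperatorSeries.
Variables (R : realType) (H : hilbertType R).
Implicit Types (V T S : H -> H) (M C D : R) (e : nat -> H) (a : nat -> R[i]).
Local Open Scope complex_scope.

Lemma series_cvg_dominated (x : nat -> H) (b : nat -> R) M : (forall k, nrm (x k) <= b k) ->
  (forall n, \sum_(0 <= k < n) b k <= M) -> cvgn (series x).
Proof.
move=> xb bM.
have b0 j : 0 <= b j by exact: le_trans (nrm_ge0 _) (xb j).
apply: nrm_cauchy_cvg => d d0.
have [N hN] := nneg_series_tail b0 (nneg_series_cvg b0 bM) d0.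
have {}hN n m : (N <= n)%N -> (n <= m)%N -> nrm (series x m - series x n) < d.
  move=> Nn nm; rewrite /series /= (big_cat_nat (leq0n n) nm)/= addrAC subrr add0r.
  rewrite (le_lt_trans (ler_nrm_sum _ _ _))// (le_lt_trans _ (hN n m Nn))//.
  by apply: ler_sum => j _; exact: xb.
exists N => n m Nn Nm; have [nm|/ltnW mn] := leqP n m; last exact: hN.
by rewrite nrmBC; exact: hN.
Qed.

Lemma bounded_by_sum (F : nat -> H -> H) (b : nat -> R) m n :
  (forall k, bounded_by (F k) (b k)) ->
  bounded_by (fun z => \sum_(m <= k < n) F k z) (\sum_(m <= k < n) b k).
Proof.
move=> h; elim: n => [|n IH].
  by under eq_fun do rewrite big_geq//; rewrite big_geq//; exact: bounded_by0.
have [mn|nm] := leqP m n; last first.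
  by under eq_fun do rewrite big_geq//; rewrite big_geq//; exact: bounded_by0.
under eq_fun do rewrite big_nat_recr//=; rewrite big_nat_recr//=.
exact: bounded_byD IH (h n).
Qed.

Lemma op_series_exists a T : bounded_by T 1 -> class_G a -> exists S, is_op_series a T S.
Proof.
move=> T1 /class_G_abs_bound[M aM].
have a0 k : 0 <= nrm (a k) by exact: nrm_ge0.
have bk k : bounded_by (fun x => a k *: iter k T x) (nrm (a k)).
  by have := bounded_byZ (a k) (bounded_by_iter k ler01 T1); rewrite expr1n mulr1.
pose S x := limn (series (fun k => a k *: iter k T x)).
have SE x : series (fun k => a k *: iter k T x) @ \oo --> S x.
  apply: (@series_cvg_dominated _ (fun k => nrm (a k) * nrm x) (M * nrm x)).
    by move=> k; exact: (proj2 (bk k)).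
  by move=> n; rewrite -mulr_suml ler_wpM2r ?nrm_ge0.
have bn n : bounded_by (fun x => series (fun k => a k *: iter k T x) n) M.
  by apply: bounded_byW (aM n) _; exact: bounded_by_sum.
have bS : bounded_by S M := bounded_by_lim bn SE.
exists S; split; first exact: bounded_by_operator bS.
have tail n m : (n <= m)%N -> bounded_by (fun x => series (fun k => a k *: iter k T x) m -
    series (fun k => a k *: iter k T x) n) (\sum_(n <= k < m) nrm (a k)).
  move=> nm; have := bounded_by_sum n m bk; congr (bounded_by _ _).
  by apply/funext => x; rewrite /series /= (big_cat_nat (leq0n n) nm)/= addrAC subrr add0r.
have ub (d : R) : 0 < d -> exists N, forall n, (N <= n)%N ->
    (op_norm (fun x => (S x - \sum_(k < n) a k *: iter k T x)%R) <= d%:E)%E.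
  move=> d0; have [N hN] := nneg_series_tail a0 (nneg_series_cvg a0 aM) d0.
  exists N => n Nn; apply: op_norm_ub; first exact: ltW.
  move=> x; rewrite -(big_mkord xpredT (fun k => a k *: iter k T x)).
  rewrite -subr_le0; have /cvg_nrmP h := SE x.
  apply: (@cvg0_le _ _ 1 (fun m => nrm (series (fun k => a k *: iter k T x) (m + n)%N - S x))); last first.
    by rewrite (cvg_shiftn n (fun m => nrm (series (fun k => a k *: iter k T x) m - S x))).
  move=> m; rewrite mul1r lerBlDr.
  set u := series (fun k => a k *: iter k T x) (m + n)%N.
  rewrite -[X in nrm (X - _) <= _](subrK u) -addrA (le_trans (ler_nrmD _ _))//.
  rewrite nrmBC lerD// (le_trans (proj2 (tail n (m + n)%N (leq_addl _ _)) x))//.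
  by rewrite ler_wpM2r ?nrm_ge0// ltW// hN.
(* Convergence in [\bar R] splits into eventual finiteness and convergence of the real values. *)
apply/fine_cvgP.
have op0 n : (0 <= op_norm (fun x => (S x - \sum_(k < n) a k *: iter k T x)%R))%E.
  apply: le_trans (ereal_sup_ubound _); last by exists 0 => //=; rewrite normr0 ler01.
  by rewrite lee_fin nrm_ge0.
split.
  have [N hN] := ub 1 ltr01; exists N => // n /= Nn.
  by rewrite ge0_fin_numE ?op0//; exact: le_lt_trans (hN n Nn) (ltry _).
apply: eventually_cvg0 => [n|d d0] /=; first by apply: fine_ge0; exact: op0.
have [N hN] := ub _ d0; exists N => n Nn.
have := hN n Nn; have := op0 n; case: (op_norm _) => //= s.
Qed.

Lemma is_op_series_cvg a T S x : bounded_by T 1 -> is_op_series a T S ->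
  series (fun k => a k *: iter k T x) @ \oo --> S x.
Proof.
move=> T1 [bS /fine_cvgP[[N1 _ hN1] /= h]]; apply/cvg_nrmP.
have [C C0 SC] := bounded_byP bS.
have bk k : bounded_by (fun x => a k *: iter k T x) (nrm (a k)).
  by have := bounded_byZ (a k) (bounded_by_iter k ler01 T1); rewrite expr1n mulr1.
apply: eventually_cvg0 => [n|d d0]; first exact: nrm_ge0.
have d1 : 0 < d / (nrm x + 1) by rewrite divr_gt0// ltr_wpDl ?nrm_ge0.
have [N2 hN2] := cvg0_eventually h d1.
exists (maxn N1 N2) => n; rewrite geq_max => /andP[n1 n2].
have fn := hN1 n n1; have := hN2 n n2.
have Sn := bounded_byB SC (bounded_by_sum 0 n bk).
set G := fun x => _ in fn *; rewrite /= => Gd.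
have GE z : G z = S z - \sum_(0 <= k < n) a k *: iter k T z by rewrite big_mkord.
have Gl : linear G by move=> c y z; rewrite !GE; exact: (proj1 Sn).
have := op_norm_le (C := d / (nrm x + 1)) Gl.
rewrite -(fineK fn) lee_fin => /(_ (ltW Gd))[_ /(_ x)].
rewrite GE nrmBC; move/le_trans; apply.
by rewrite mulrAC ler_pdivrMr ?ltr_wpDl ?nrm_ge0//; have := nrm_ge0 x; nra.
Qed.

(** Existence excludes the default value of [xget], and whatever operator is chosen must be the
    pointwise sum of the series. *)
Lemma op_fun_cvg a T : bounded_by T 1 -> class_G a -> bounded_operator (op_fun a T) /\
  forall x, series (fun k => a k *: iter k T x) @ \oo --> op_fun a T x.
Proof.
move=> T1 Ga; have [S TS] := op_series_exists T1 Ga.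
have h : is_op_series a T (op_fun a T).
  by rewrite /op_fun; case: xgetP => [S' _ //|/(_ S TS)].
by split; [case: h|move=> x; exact: (@is_op_series_cvg a T _ x T1 h)].
Qed.

End OperatorSeries.

(** * Traces of differences of powers and of power series *)

Section TraceOfPowers.
Variables (R : realType) (H : hilbertType R).
Implicit Types (V S : H -> H) (C D : R) (a : nat -> R[i]).
Local Open Scope complex_scope.

Lemma tn_le_ge0 V M : tn_le V M -> 0 <= M.
Proof.
move=> /(_ 0%N (fun=> 0) (fun=> 0)); rewrite big_geq//; apply.
  by move=> z; rewrite big_geq// sqr_ge0.
by move=> z; rewrite big_geq// sqr_ge0.
Qed.

(** Test families are stable under contractions, so the factor [D] is recovered by rescaling [T] to
    [D^-1 T]; this is why [D], and later [r], must be positive. *)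
Lemma tn_le_compr_scale V T S M D : linear V -> 0 < D -> bounded_by T D -> is_adjoint T S ->
  tn_le V M -> tn_le (V \o T) (D * M).
Proof.
move=> Vl D0 TD TS VM.
have h : is_adjoint (fun z => D^-1%:C *: T z) (fun z => D^-1%:C *: S z).
  by move=> x y; rewrite innerZl innerZr conjc_real TS.
have b : bounded_by (fun z => D^-1%:C *: S z) 1.
  have := bounded_byZ D^-1%:C (adjoint_bounded (ltW D0) TD TS).
  by rewrite nrm_real gtr0_norm ?invr_gt0// mulVf ?gt_eqF.
have := tn_leZ D%:C (tn_le_compr h b VM); rewrite nrm_real gtr0_norm//.
congr (tn_le _ _); apply/funext => z /=.
by rewrite (linZ Vl) scalerA -rmorphM /= mulfV ?gt_eqF// scale1r.
Qed.

Lemma is_adjoint_iter T S n : is_adjoint T S -> is_adjoint (iter n T) (iter n S).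
Proof. by move=> TS; elim: n => [//|n IH] x y; rewrite iterS TS IH -iterSr. Qed.

Variables (e : nat -> H) (T T0 : H -> H) (r M : R).
Hypothesis eONB : orthonormal_basis e.
Hypothesis T1 : bounded_by T 1.
Hypothesis r01 : 0 < r < 1.
Hypothesis T0r : bounded_by T0 r.
Hypothesis VM : tn_le (T \- T0) M.

Let pow_diff n z := iter n T z - iter n T0 z.

Lemma pow_diff_tn_le n : tn_le (pow_diff n) (M / (1 - r)).
Proof.
have /andP[r0 r1] := r01; have M0 := tn_le_ge0 VM.
(* The sharper bound is the one that induction preserves: T^(n+1) - T0^(n+1) = T (T^n - T0^n) + (T -
   T0) T0^n adds r^n M, the next term of the geometric sum. *)
suff : tn_le (pow_diff n) (M * (1 - r ^+ n) / (1 - r)).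
  apply: tn_leW; rewrite ler_pM2r ?invr_gt0 ?subr_gt0//.
  by rewrite ler_piMr// gerBl exprn_ge0// ltW.
have [S0 TS0] := adjoint_exists eONB (ltW r0) T0r.
have [S TS] := adjoint_exists eONB ler01 T1.
have Vl : linear (T \- T0) := proj1 (bounded_byB T1 T0r).
elim: n => [|n IH].
  rewrite expr0 subrr mulr0 mul0r; have := @tn_le0 _ H; congr (tn_le _ _).
  by apply/funext => z; rewrite /pow_diff subrr.
have h1 := tn_le_compl TS T1 IH.
have h2 := tn_le_compr_scale Vl (exprn_gt0 n r0) (bounded_by_iter n (ltW r0) T0r)
  (is_adjoint_iter n TS0) VM.
have := tn_leD h1 h2; rewrite (_ : _ / _ + _ = M * (1 - r ^+ n.+1) / (1 - r)).
  congr (tn_le _ _); apply/funext => z /=.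
  by rewrite /pow_diff (linB (proj1 T1)) -iterS addrA subrK.
have r1' : 1 - r != 0 by rewrite subr_eq0 gt_eqF.
by rewrite exprS; field.
Qed.

Lemma pow_diff_bounded n : bounded_by (pow_diff n) (1 ^+ n + r ^+ n).
Proof.
have /andP[r0 _] := r01.
exact: bounded_byB (bounded_by_iter n ler01 T1) (bounded_by_iter n (ltW r0) T0r).
Qed.

Lemma pow_diff_trace : exists tau : nat -> R[i], [/\ forall n, is_trace (pow_diff n) (tau n),
  forall n, nrm (tau n) <= M / (1 - r) & tau 0%N = 0].
Proof.
have tc n : exists c, is_trace (pow_diff n) c.
  apply: trace_class_trace; apply: tn_le_trace_class eONB _ (pow_diff_tn_le n).
  exact: bounded_by_operator (pow_diff_bounded n).
have [tau htau] := choice tc; exists tau; split => // [n|].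
  exact: is_trace_nrm_le eONB (pow_diff_tn_le n) (htau n).
(* The zeroth difference is the zero operator. Its trace 0 will have to agree with mode 0 of [xi],
   which is always 0. *)
have [_ /(_ e eONB) h] := htau 0%N; apply: cvg_complex_unique h _.
rewrite (_ : series _ = fun=> 0); first exact: cvg_cst.
apply/funext => m; rewrite /series /= big1// => k _.
by rewrite /pow_diff subrr inner0l.
Qed.

(** The trace is continuous for the trace norm. If c' is the trace of [W], then [W - Wn] has trace
    c' minus the n-th partial sum, and this is at most [K] times a tail of the sum of |a_k|. *)
Lemma op_fun_trace tau a c : (forall n, is_trace (pow_diff n) (tau n)) ->
  class_G a -> series (fun k => a k * tau k) @ \oo --> c ->
  is_trace (op_fun a T \- op_fun a T0) c.
Proof.
move=> htau Ga hc; set K := M / (1 - r).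
have /andP[r0 r1] := r01.
have T01 := bounded_byW (ltW r1) T0r.
have [bT cT] := op_fun_cvg T1 Ga; have [bT0 cT0] := op_fun_cvg T01 Ga.
have [A aA] := class_G_abs_bound Ga.
have K0 : 0 <= K := tn_le_ge0 (pow_diff_tn_le 0).
have a0 k : 0 <= nrm (a k) by exact: nrm_ge0.
pose Wn n z := \sum_(0 <= k < n) a k *: pow_diff k z.
set W := _ \- _; have WE z : Wn ^~ z @ \oo --> W z.
  rewrite (_ : Wn ^~ z = fun n => series (fun k => a k *: iter k T z) n -
     series (fun k => a k *: iter k T0 z) n); first exact: cvgB.
  apply/funext => n; rewrite /Wn /series /= -sumrB; apply: eq_bigr => k _.
  by rewrite scalerBr.
have tn_k k : tn_le (fun z => a k *: pow_diff k z) (nrm (a k) * K).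
  exact: tn_leZ (pow_diff_tn_le k).
have [C C0 WC] : exists2 C, 0 < C & bounded_by W C.
  have [C1 C10 b1] := bounded_byP bT; have [C2 C20 b2] := bounded_byP bT0.
  by exists (C1 + C2); [exact: addr_gt0|exact: bounded_byB].
have bWn n := bounded_by_sum 0 n (fun k => bounded_byZ (a k) (pow_diff_bounded k)).
have tail n : forall d, (forall m, \sum_(n <= k < m) nrm (a k) <= d) ->
    tn_le (fun z => W z - Wn n z) (d * K).
  move=> d hd; apply: (@tn_le_lim _ _ (fun m z => Wn (m + n)%N z - Wn n z)).
    move=> m; apply: (@tn_leW _ _ _ (\sum_(n <= k < m + n) nrm (a k) * K)).
      by rewrite -mulr_suml ler_wpM2r.
    have := tn_le_sum n (m + n) tn_k; congr (tn_le _ _); apply/funext => z.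
    by rewrite /Wn (big_cat_nat (leq0n n) (leq_addl m n))/= addrAC subrr add0r.
  move=> z; apply: cvgB; last exact: cvg_cst.
  by rewrite (cvg_shiftn n (Wn ^~ z)).
have tW n : trace_class (fun z => W z - Wn n z).
  apply: tn_le_trace_class eONB _ (tail n A _).
    exact: bounded_by_operator (bounded_byB WC (bWn n)).
  move=> m; apply: le_trans (aA m); have [nm|mn] := leqP n m.
    by rewrite [leRHS](big_cat_nat (leq0n n) nm)/= lerDr sumr_ge0.
  by rewrite (big_geq (ltnW mn)) sumr_ge0.
have tW0 : trace_class W.
  have := tW 0%N; congr (trace_class _); apply/funext => z.
  by rewrite /Wn big_geq// subr0.
have [c' hc'] := trace_class_trace tW0.
suff -> : c = c' by [].
have trn n : is_trace (fun z => W z - Wn n z) (c' - series (fun k => a k * tau k) n).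
  split=> [|e' eONB']; first exact: tW.
  elim: n => [|n IH].
    have -> : series (fun k => a k * tau k) 0 = 0 by rewrite /series /= big_geq.
    rewrite subr0.
    apply: (@eq_cvgn R[i] _ _ _ _ (proj2 hc' _ eONB')) => m.
    apply: eq_bigr => k _; by rewrite /Wn big_geq// subr0.
  have h := cvg_complexD IH (@cvg_complexMl _ _ _ (- a n) (proj2 (htau n) _ eONB')).
  move: h; rewrite (_ : _ + _ = c' - series (fun k => a k * tau k) n.+1); last first.
    by rewrite /series /= big_nat_recr//= opprD addrA mulNr.
  apply: (@eq_cvgn R[i]) => m; rewrite /series /= mulr_sumr -big_split /=.
  apply: eq_bigr => k _; rewrite mulNr -innerZl -innerBl; congr (inner _ _).
  by rewrite /Wn big_nat_recr//= opprD addrA.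
apply/eqP; rewrite -subr_eq0 -nrm_eq0 eq_le nrm_ge0 andbT.
apply/ler_addgt0Pl => d d0; rewrite addr0.
(* [K + 1] rather than [K], which may be 0. *)
have d2 : 0 < d / (2 * (K + 1)) by rewrite divr_gt0// mulr_gt0// ltr_wpDl.
have [N hN] := nneg_series_tail a0 (nneg_series_cvg a0 aA) d2.
have /cvg_complex_nrmP/cvg0_eventually/(_ (divr_gt0 d0 (ltr0n _ 2)))[N' hN'] := hc.
pose n := maxn N N'.
have h1 := hN' n (leq_maxr _ _).
have h2 : nrm (c' - series (fun k => a k * tau k) n) <= d / (2 * (K + 1)) * K.
  apply: is_trace_nrm_le eONB (tail _ _ _) (trn n) => m; apply/ltW/hN.
  exact: leq_maxl.
have h3 : d / (2 * (K + 1)) * K <= d / 2.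
  rewrite mulrAC ler_pdivrMr ?mulr_gt0// ?ltr_wpDl//; nra.
have -> : c - c' = - ((series (fun k => a k * tau k) n - c) +
  (c' - series (fun k => a k * tau k) n)) by ring.
rewrite nrmN (le_trans (ler_nrmD _ _))//; move: h1 => /= h1; lra.
Qed.

End TraceOfPowers.

(** * Fourier analysis on the period *)

Section PeriodIntegral.
Variable R : realType.
Local Notation mu := (@lebesgue_measure R).
Local Notation per := (@period R : set (measurableTypeR R)).
Implicit Types (f g xi : R -> R) (t p q : R).

Lemma measurable_period : measurable per.
Proof. exact: measurable_itv. Qed.
Hint Resolve measurable_period : core.

Lemma pi2_gt0 : 0 < 2 * pi :> R.
Proof. by rewrite mulr_gt0// pi_gt0. Qed.

Lemma L1_continuous f : continuous f -> L1_period f.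
Proof.
move=> cf; apply: continuous_compact_integrable; first exact: segment_compact.
by apply: continuous_subspaceT; exact: cf.
Qed.

Lemma L1_measurable f : L1_period f -> measurable_fun per f.
Proof. by move=> /measurable_int/measurable_EFinP. Qed.

Lemma period_measurable f : continuous f -> measurable_fun per f.
Proof. by move=> /L1_continuous/L1_measurable. Qed.

Lemma L1_mul g xi (C : R) : measurable_fun per g -> (forall t, `|g t| <= C) ->
  L1_period xi -> L1_period (fun t => g t * xi t).
Proof.
move=> mg gC ixi; have := integrableMr measurable_period mg _ ixi; apply.
exists C; split; first exact: num_real.
by move=> x Cx t _ /=; rewrite (le_trans (gC t))// ltW.
Qed.

Lemma L1_mul_continuous g xi (C : R) : continuous g -> (forall t, `|g t| <= C) ->
  L1_period xi -> L1_period (fun t => g t * xi t).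
Proof.
by move=> /period_measurable; exact: L1_mul.
Qed.

Lemma L1D f g : L1_period f -> L1_period g -> L1_period (fun t => f t + g t).
Proof. by move=> h1 h2; exact: (integrableD measurable_period h1 h2). Qed.

Lemma L1B f g : L1_period f -> L1_period g -> L1_period (fun t => f t - g t).
Proof. by move=> h1 h2; exact: (integrableB measurable_period h1 h2). Qed.

Lemma L1Z f p : L1_period f -> L1_period (fun t => p * f t).
Proof. by move=> h1; exact: (integrableZl measurable_period p h1). Qed.

Lemma L1_sum (F : nat -> R -> R) m n : (forall k, L1_period (F k)) ->
  L1_period (fun t => \sum_(m <= k < n) F k t).
Proof.
move=> h; elim: n => [|n IH].
  by under eq_fun do rewrite big_geq//; apply: L1_continuous => t; exact: cvg_cst.
have [mn|nm] := leqP m n; last first.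
  by under eq_fun do rewrite big_geq//; apply: L1_continuous => t; exact: cvg_cst.
by under eq_fun do rewrite big_nat_recr//=; exact: L1D.
Qed.

Lemma period_int_cst p : \int[mu]_(_ in per) p = p * (2 * pi).
Proof.
rewrite Rintegral_cst//; have := lebesgue_measure_itv `[0, (2 * pi : R)].
by rewrite /= lte_fin pi2_gt0 oppr0 adde0 => ->.
Qed.

Lemma period_int_sum (F : nat -> R -> R) m n : (forall k, L1_period (F k)) ->
  \int[mu]_(t in per) (\sum_(m <= k < n) F k t) = \sum_(m <= k < n) \int[mu]_(t in per) F k t.
Proof.
move=> h; elim: n => [|n IH].
  rewrite big_geq//; under eq_Rintegral do rewrite big_geq//.
  by rewrite period_int_cst mul0r.
have [mn|nm] := leqP m n; last first.
  rewrite big_geq//; under eq_Rintegral do rewrite big_geq//.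
  by rewrite period_int_cst mul0r.
rewrite big_nat_recr//= -IH.
transitivity (\int[mu]_(t in per) (\sum_(m <= k < n) F k t + F n t)).
  by apply: eq_Rintegral => t _; rewrite big_nat_recr.
apply: RintegralD; [exact: measurable_period|exact: L1_sum|exact: h].
Qed.

Lemma period_int_FTC f F : continuous f -> (forall t, is_derive t 1 F (f t)) ->
  \int[mu]_(t in per) f t = F (2 * pi) - F 0.
Proof.
move=> cf dF; have cF : continuous F.
  by move=> t; apply: differentiable_continuous; apply/derivable1_diffP; case: (dF t).
rewrite /Rintegral (@continuous_FTC2 _ f F 0 (2 * pi) pi2_gt0)//.
- exact: continuous_subspaceT.
- split => [t _||]; first by case: (dF t).
    exact: cvg_at_right_filter (cF _).
  exact: cvg_at_left_filter (cF _).
- by move=> t _; rewrite derive1E; case: (dF t).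
Qed.

Lemma period_dominated (f_ : nat -> R -> R) f (g : R -> \bar R) :
  (forall n, L1_period (f_ n)) -> measurable_fun per f ->
  {ae mu, forall t, per t -> f_ ^~ t @ \oo --> f t} ->
  mu.-integrable per g ->
  (forall n t, per t -> (`|f_ n t|%:E <= g t)%E) ->
  L1_period f /\
  (fun n => \int[mu]_(t in per) f_ n t) @ \oo --> \int[mu]_(t in per) f t.
Proof.
move=> If mf ff ig fg.
have [||| h1 _ h2] := @dominated_convergence _ _ _ mu _ measurable_period
  (fun n => EFin \o f_ n) (EFin \o f) g
  (fun n => measurable_int _ (If n)) _ _ ig _.
- exact/measurable_EFinP.
- move: ff; apply: filterS; first exact: (ae_filter_ringOfSetsType mu).
  move=> t h pt; apply/fine_cvgP; split; first exact: nearW.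
  exact: h.
- by apply: aeW => t n pt; exact: fg.
split => //; apply: fine_cvg => //.
by rewrite fineK ?h2// integrable_fin_num.
Qed.

End PeriodIntegral.

Section Trig.
Variable R : realType.
Local Notation mu := (@lebesgue_measure R).
Local Notation per := (@period R : set (measurableTypeR R)).
Implicit Types (f g xi : R -> R) (t p q k : R).

(** This family is closed under differentiation and translation. The frequency [k] is real so as to
    include the differences m - n produced by products. *)
Definition trig p q k t := p * cos (k * t) + q * sin (k * t).

Lemma is_derive_trig p q k t : is_derive t 1 (trig p q k) (trig (k * q) (- (k * p)) k t).
Proof.
have dk : is_derive t 1 (fun u => k * u) k.
  have := @is_deriveZ _ _ _ (@id R) k t 1 1 (is_derive_id t 1).
  by rewrite /GRing.scale /= mulr1.
have dc := is_derive1_comp (is_derive_cos (k * t)) dk.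
have ds := is_derive1_comp (is_derive_sin (k * t)) dk.
have := is_deriveD (is_deriveZ p dc) (is_deriveZ q ds).
rewrite (_ : _ + _ = trig p q k)// (_ : _ + _ = trig (k * q) (- (k * p)) k t)//.
by rewrite /trig /GRing.scale /=; ring.
Qed.

Lemma continuous_trig p q k : continuous (trig p q k).
Proof.
move=> t; apply: differentiable_continuous; apply/derivable1_diffP.
by case: (is_derive_trig p q k t).
Qed.

Lemma trig_bound p q k t : `|trig p q k t| <= `|p| + `|q|.
Proof.
rewrite (le_trans (ler_normD _ _))// !normrM lerD// ler_piMr// ?cos_max//.
exact: sin_max.
Qed.

Lemma L1_trigM p q k xi : L1_period xi -> L1_period (fun t => trig p q k t * xi t).
Proof. by apply: L1_mul_continuous; [exact: continuous_trig|exact: trig_bound]. Qed.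

Lemma natr_2pi n : n%:R * (2 * pi) = 0 + pi *+ 2 *+ n :> R.
Proof. by rewrite add0r -[RHS]mulr_natl -[pi *+ 2]mulr_natl. Qed.

Lemma sin_n2pi n : sin (n%:R * (2 * pi)) = 0 :> R.
Proof. by rewrite natr_2pi (periodicn (@sinD2pi R)) sin0. Qed.

Lemma cos_n2pi n : cos (n%:R * (2 * pi)) = 1 :> R.
Proof. by rewrite natr_2pi (periodicn (@cosD2pi R)) cos0. Qed.

Lemma period_int_trig p q k : k != 0 -> sin (k * (2 * pi)) = 0 -> cos (k * (2 * pi)) = 1 ->
  \int[mu]_(t in per) trig p q k t = 0.
Proof.
move=> k0 s c.
have d t : is_derive t 1 (trig (- q / k) (p / k) k) (trig p q k t).
  have := is_derive_trig (- q / k) (p / k) k t.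
  rewrite mulrCA divff// mulr1 (_ : - (k * (- q / k)) = q)//.
  by field.
rewrite (period_int_FTC (@continuous_trig p q k) d).
by rewrite /trig s c (mulr0 k) cos0 sin0 subrr.
Qed.

(** Product-to-sum formulas: [F] carries the frequency m - n and [G] the frequency m + n, and only
    [F] with m = n has a constant part. *)
Lemma period_int_trigM m n p q p' q' : (0 < m)%N -> (0 < n)%N ->
  \int[mu]_(t in per) (trig p q m%:R t * trig p' q' n%:R t) =
  if m == n then pi * (p * p' + q * q') else 0.
Proof.
move=> m0 n0; set a := m%:R : R; set b := n%:R : R.
pose F t := trig ((p * p' + q * q') / 2) ((q * p' - p * q') / 2) (a - b) t.
pose G t := trig ((p * p' - q * q') / 2) ((q * p' + p * q') / 2) (a + b) t.
transitivity (\int[mu]_(t in per) (F t + G t)).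
  apply: eq_Rintegral => t _; rewrite /F /G /trig [(a - b) * t]mulrBl [(a + b) * t]mulrDl.
  by rewrite cosB cosD sinB sinD; field.
have cF : continuous F by exact: continuous_trig.
have cG : continuous G by exact: continuous_trig.
rewrite RintegralD; [|exact: measurable_period|exact: L1_continuous|exact: L1_continuous].
rewrite [X in _ + X]period_int_trig; last 3 first.
- by rewrite -natrD pnatr_eq0 addn_eq0 negb_and -!lt0n m0.
- by rewrite mulrDl sinD !sin_n2pi !mul0r mulr0 addr0.
- by rewrite mulrDl cosD !sin_n2pi !cos_n2pi mul0r subr0 mulr1.
rewrite addr0; have [mn|mn] := eqVneq m n.
  rewrite (_ : \int[mu]_(t in per) F t = \int[mu]_(t in per) ((p * p' + q * q') / 2)).
    by rewrite period_int_cst; field.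
  apply: eq_Rintegral => t _; rewrite /F /trig /a /b mn subrr mul0r cos0 sin0 mulr0 addr0.
  by rewrite mulr1.
rewrite period_int_trig//.
- by rewrite subr_eq0 eqr_nat.
- by rewrite mulrBl sinB !sin_n2pi !mul0r mulr0 subr0.
- by rewrite mulrBl cosB !sin_n2pi !cos_n2pi mul0r addr0 mulr1.
Qed.

End Trig.

Lemma continuous_sum_nat (R : realType) (F : nat -> R -> R) n :
  (forall k, continuous (F k)) -> continuous (fun t => \sum_(0 <= k < n) F k t).
Proof.
move=> cF; elim: n => [|n IH].
  rewrite (_ : (fun t => _) = fun=> 0); first by move=> t; exact: cvg_cst.
  by apply/funext => t; rewrite big_geq.
rewrite (_ : (fun t => _) = fun t => \sum_(0 <= k < n) F k t + F n t).
  by move=> t; apply: cvgD; [exact: IH|exact: cF].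
by apply/funext => t; rewrite big_nat_recr.
Qed.

(** * Termwise differentiation of a dominated series *)

Section TermwiseDerivative.
Variable R : realType.
Variables (u v : nat -> R -> R) (b : nat -> R) (M : R) (U V : R -> R).
Hypothesis uv : forall k (t : R), is_derive t 1 (u k) (v k t).
Hypothesis vb : forall k t, `|v k t| <= b k.
Hypothesis bM : forall n, \sum_(0 <= k < n) b k <= M.
Hypothesis uU : forall t, (fun n => \sum_(0 <= k < n) u k t) @ \oo --> U t.
Hypothesis vV : forall t, (fun n => \sum_(0 <= k < n) v k t) @ \oo --> V t.

Let b0 k : 0 <= b k. Proof. exact: le_trans (normr_ge0 _) (vb k 0). Qed.

Lemma is_derive_sum_nat n (t : R) :
  is_derive t 1 (fun s => \sum_(0 <= k < n) u k s) (\sum_(0 <= k < n) v k t).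
Proof.
elim: n => [|n IH].
  rewrite big_geq//; under eq_fun do rewrite big_geq//; exact: is_derive_cst.
rewrite big_nat_recr//=; under eq_fun do rewrite big_nat_recr//=.
exact: is_deriveD IH (uv n t).
Qed.

Lemma increment_bound (F f : R -> R) (c s t : R) :
  (forall x : R, is_derive x 1 F (f x)) -> (forall x, `|f x| <= c) ->
  `|F s - F t| <= c * `|s - t|.
Proof.
move=> Ff fc; wlog st : s t / s <= t => [h|].
  have [st|/ltW ts] := leP s t; first exact: h.
  by rewrite distrC (distrC s) h.
have cF : {within `[s, t], continuous F}.
  apply: continuous_subspaceT => x; apply: differentiable_continuous.
  by apply/derivable1_diffP; case: (Ff x).
have [x _ E] := MVT_segment st (fun x _ => Ff x) cF.
by rewrite distrC E normrM (distrC t) ler_wpM2r.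
Qed.

Lemma tail_bound (w : nat -> R) (W : R) J : (forall k, `|w k| <= b k) ->
  (fun n => \sum_(0 <= k < n) w k) @ \oo --> W ->
  forall d, (forall m, \sum_(J <= k < m) b k <= d) ->
  `|W - \sum_(0 <= k < J) w k| <= d.
Proof.
move=> wb wW d hd.
have h : (fun n => `|\sum_(0 <= k < n + J) w k - \sum_(0 <= k < J) w k|) @ \oo -->
    `|W - \sum_(0 <= k < J) w k|.
  apply: cvg_norm; apply: cvgB; last exact: cvg_cst.
  by rewrite (cvg_shiftn J (fun n => \sum_(0 <= k < n) w k)).
apply: ler_cvgn_const h => n.
rewrite (big_cat_nat (leq0n J) (leq_addl n J))/= addrAC subrr add0r.
rewrite (le_trans (ler_norm_sum _ _ _))// (le_trans _ (hd (n + J)%N))//.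
by apply: ler_sum.
Qed.

(** By the mean value theorem the difference quotients of [u k] are bounded by [b k] too. Beyond one
    index [J], the tails of both series are then at most e/3 uniformly in [h], and only the finite
    sum has to be differentiated. *)
Lemma is_derive_series (t : R) : is_derive t 1 U (V t).
Proof.
suff h : h^-1 *: (U (h *: 1 + t) - U t) @[h --> 0^'] --> V t.
  split; first by apply/cvg_ex; exists (V t).
  by apply/cvg_lim => //; exact: Rhausdorff.
apply/cvgrPdist_le => e e0.
have e3 : 0 < e / 3 by rewrite divr_gt0.
have [J hJ] := nneg_series_tail b0 (nneg_series_cvg b0 bM) e3.
have hJ' m : \sum_(J <= k < m) b k <= e / 3 by exact: ltW (hJ J m (leqnn J)).
pose S s := \sum_(0 <= k < J) u k s.
have [dS eS] := is_derive_sum_nat J t.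
have Sd : h^-1 *: (S (h *: 1 + t) - S t) @[h --> 0^'] --> \sum_(0 <= k < J) v k t.
  by rewrite -eS; exact: dS.
have /cvgrPdist_le/(_ _ e3) Sd' := Sd.
near=> h.
have h0 : h != 0 by near: h; exact: nbhs_dnbhs_neq.
have A1 : `|\sum_(0 <= k < J) v k t - h^-1 *: (S (h *: 1 + t) - S t)| <= e / 3.
  by near: h; exact: Sd'.
have A2 : `|V t - \sum_(0 <= k < J) v k t| <= e / 3.
  exact: (@tail_bound (fun k => v k t) _ _ (fun k => vb k t) (@vV t) _ hJ').
set s := h *: 1 + t in A1 *.
have A3 : `|h^-1 *: (S s - S t) - h^-1 *: (U s - U t)| <= e / 3.
  have st : s - t = h by rewrite /s addrK /GRing.scale /= mulr1.
  have Q : `|(U s - U t) / h - \sum_(0 <= k < J) (u k s - u k t) / h| <= e / 3.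
    apply: (@tail_bound (fun k => (u k s - u k t) / h) _ _ _ _ _ hJ').
      move=> k; rewrite normrM normfV ler_pdivrMr ?normr_gt0// -st.
      exact: increment_bound (uv k) (vb k).
    rewrite (_ : (fun n => _) = fun n => (\sum_(0 <= k < n) u k s - \sum_(0 <= k < n) u k t) / h).
      by apply: cvgMl; apply: cvgB; exact: uU.
    by apply/funext => n; rewrite -mulr_suml sumrB.
  have -> : h^-1 *: (S s - S t) - h^-1 *: (U s - U t) =
      - ((U s - U t) / h - \sum_(0 <= k < J) (u k s - u k t) / h).
    by rewrite -mulr_suml sumrB -/(S s) -/(S t) /GRing.scale /=; ring.
  by rewrite normrN.
have -> : V t - h^-1 *: (U s - U t) = (V t - \sum_(0 <= k < J) v k t) +
  (\sum_(0 <= k < J) v k t - h^-1 *: (S s - S t)) + (h^-1 *: (S s - S t) - h^-1 *: (U s - U t)).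
  by ring.
rewrite (le_trans (ler_normD _ _))//; have := ler_normD (V t - \sum_(0 <= k < J) v k t)
  (\sum_(0 <= k < J) v k t - h^-1 *: (S s - S t)); lra.
Unshelve. all: by end_near. Qed.

End TermwiseDerivative.

(** * Pairing the derivative on the circle with xi *)

Section CirclePairing.
Variable R : realType.
Local Notation mu := (@lebesgue_measure R).
Local Notation per := (@period R : set (measurableTypeR R)).
Local Open Scope complex_scope.
Implicit Types (a : nat -> R[i]) (xi : R -> R).

(* The integral of d/dt e^{int} against xi. *)
Definition mode xi (n : nat) : R[i] :=
  (\int[mu]_(t in per) (trig 0 (- n%:R) n%:R t * xi t)) +i*
  (\int[mu]_(t in per) (trig n%:R 0 n%:R t * xi t)).

Lemma expiX (t : R) n : expi t ^+ n = cos (n%:R * t) +i* sin (n%:R * t).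
Proof.
elim: n => [|n IH]; first by rewrite expr0 mul0r cos0 sin0.
rewrite exprS IH /expi -natr1 mulrDl mul1r [n%:R * t + t]addrC cosD sinD.
by apply/eqP; rewrite eq_complex /= eqxx/=; apply/eqP; ring.
Qed.

Lemma Re_circle_term a t k :
  complex.Re (a k * expi t ^+ k) = trig (complex.Re (a k)) (- complex.Im (a k)) k%:R t.
Proof. by rewrite expiX /trig; case: (a k) => x y /=; ring. Qed.

Lemma Im_circle_term a t k :
  complex.Im (a k * expi t ^+ k) = trig (complex.Im (a k)) (complex.Re (a k)) k%:R t.
Proof. by rewrite expiX /trig; case: (a k) => x y /=; ring. Qed.

Lemma nrm_expi (t : R) : nrm (expi t) = 1.
Proof.
have := sqr_nrmE (expi t); rewrite /= cos2Dsin2 => /eqP.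
rewrite sqrf_eq1 => /orP[/eqP //|/eqP h].
by have := nrm_ge0 (expi t); rewrite h ler0N1.
Qed.

Lemma circle_fun_cvg a t : class_G a ->
  series (fun k => a k * expi t ^+ k) @ \oo --> circle_fun a t.
Proof.
move=> /class_G_abs_bound[M aM].
have xa k : nrm (a k * expi t ^+ k) <= nrm (a k).
  by rewrite nrmM nrmX nrm_expi expr1n mulr1.
have [l al] := complex_series_cvg xa aM.
have := @cvg_lim _ (@norm_hausdorff _ R[i]^o) _ _ _ _ _ al.
by rewrite /circle_fun => ->.
Qed.

Lemma ler_ReIm_nrm (z : R[i]) : `|complex.Re z| + `|complex.Im z| <= 2 * nrm z.
Proof. by have := ler_Re_nrm z; have := ler_Im_nrm z; lra. Qed.

(* The real and imaginary parts of phi(e^{it}) are series of the form below. *)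
Lemma trig_series_pairing (p q : nat -> R) (M : R) (U : R -> R) xi :
  (forall n, \sum_(0 <= k < n) k%:R * (`|p k| + `|q k|) <= M) ->
  (forall t, (fun n => \sum_(0 <= k < n) trig (p k) (q k) k%:R t) @ \oo --> U t) ->
  L1_period xi ->
  (fun n => \sum_(0 <= k < n)
     \int[mu]_(t in per) (trig (k%:R * q k) (- (k%:R * p k)) k%:R t * xi t)) @ \oo -->
  \int[mu]_(t in per) (derive1 U t * xi t).
Proof.
move=> pqM hU ixi.
pose b k := k%:R * (`|p k| + `|q k|).
pose v k := trig (k%:R * q k) (- (k%:R * p k)) k%:R.
have vb k t : `|v k t| <= b k.
  by rewrite (le_trans (trig_bound _ _ _ _))// normrN !normrM normr_nat -mulrDr addrC.
have b0 k : 0 <= b k by exact: le_trans (vb k 0).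
have vcv t : cvgn (fun n => \sum_(0 <= k < n) v k t).
  apply: normed_cvg; apply: (@nneg_series_cvg _ (fun k => `|v k t|) M) => [//|n].
  by rewrite (le_trans _ (pqM n))//; apply: ler_sum => k _; exact: vb.
pose V t := limn (fun n => \sum_(0 <= k < n) v k t).
have vV t : (fun n => \sum_(0 <= k < n) v k t) @ \oo --> V t by exact: vcv.
have dU t : derive1 U t = V t.
  rewrite derive1E.
  have := is_derive_series (fun k s => is_derive_trig (p k) (q k) k%:R s) vb pqM hU vV t.
  by case.
have vL1 k : L1_period (fun t => v k t * xi t).
  exact: L1_trigM.
have sL1 n : L1_period (fun t => \sum_(0 <= k < n) v k t * xi t) by exact: L1_sum.
have mV : measurable_fun per V.
  apply: (@measurable_fun_cvg _ _ _ _ (fun n t => \sum_(0 <= k < n) v k t)).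
    move=> n; apply: period_measurable.
    by apply: continuous_sum_nat => k; exact: continuous_trig.
  by move=> t _; exact: vV.
have gL1 : mu.-integrable per (fun t => (M * `|xi t|)%:E).
  have h : L1_period (fun t => `|xi t|) := integrable_abse ixi.
  exact: (L1Z M h).
have [] := @period_dominated _ (fun n t => \sum_(0 <= k < n) v k t * xi t)
  (fun t => V t * xi t) _ sL1 _ _ gL1 _.
- by apply: measurable_funM => //; exact: L1_measurable.
- apply: aeW => t _; under eq_fun do rewrite -mulr_suml.
  by apply: cvgMl; exact: vV.
- move=> n t _; rewrite lee_fin -mulr_suml normrM ler_wpM2r//.
  rewrite (le_trans (ler_norm_sum _ _ _))// (le_trans _ (pqM n))//.
  by apply: ler_sum => k _; exact: vb.
move=> _ h; under [X in _ --> X]eq_Rintegral do rewrite dU.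
by apply: eq_cvgn h => n; exact: period_int_sum.
Qed.

(** As [xi] is real, the two parts separate: the real part of phi(e^{it}) has cosine and sine
    coefficients (Re a_k, - Im a_k), the imaginary part (Im a_k, Re a_k). The bound [2 * M] comes
    from |Re z| + |Im z| <= 2 |z|. *)
Lemma circle_pairing a xi : class_G a -> L1_period xi ->
  series (fun k => a k * mode xi k) @ \oo -->
    Cintegral per (fun t => cderive1 (circle_fun a) t * (xi t)%:C).
Proof.
move=> Ga ixi; have [M aM] := class_G_bound Ga.
have bnd n : \sum_(0 <= k < n) k%:R * (`|complex.Re (a k)| + `|complex.Im (a k)|) <= 2 * M.
  apply: le_trans (ler_wpM2l _ (aM n)) => //; rewrite mulr_sumr; apply: ler_sum => k _.
  by rewrite nrm_natl mulrCA ler_wpM2l// ler_ReIm_nrm.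
have L1t p q k : L1_period (fun t => trig p q k t * xi t) by exact: L1_trigM.
have split_trig p q (k : nat) : \int[mu]_(t in per) (trig (k%:R * q) (- (k%:R * p)) k%:R t * xi t) =
    p * \int[mu]_(t in per) (trig 0 (- k%:R) k%:R t * xi t) +
    q * \int[mu]_(t in per) (trig k%:R 0 k%:R t * xi t).
  rewrite -(RintegralZl p (@measurable_period R) (L1t _ _ _)).
  rewrite -(RintegralZl q (@measurable_period R) (L1t _ _ _)).
  rewrite -RintegralD; [|exact: measurable_period|exact: L1Z|exact: L1Z].
  by apply: eq_Rintegral => t _; rewrite /trig; ring.
apply: cvg_ReIm.
- rewrite /Cintegral /=.
  have h := @trig_series_pairing (fun k => complex.Re (a k)) (fun k => - complex.Im (a k))
    (2 * M) (fun t => complex.Re (circle_fun a t)) xi _ _ ixi.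
  have := h _ _; rewrite (_ : (fun n => _) = fun n => complex.Re (series (fun k => a k * mode xi k) n)); last first.
    apply/funext => n; rewrite /series /= raddf_sum; apply: eq_bigr => k _.
    by rewrite split_trig /mode; case: (a k) => x y /=; ring.
  under [in X in _ -> X]eq_Rintegral do rewrite /cderive1 /= mulr0 subr0.
  apply.
    by move=> n; under eq_bigr do rewrite normrN; exact: bnd.
  move=> t; apply: eq_cvgn (cvg_Re (@circle_fun_cvg a t Ga)) => n.
  by rewrite /series /= raddf_sum; apply: eq_bigr => k _; exact: Re_circle_term.
- rewrite /Cintegral /=.
  have h := @trig_series_pairing (fun k => complex.Im (a k)) (fun k => complex.Re (a k))
    (2 * M) (fun t => complex.Im (circle_fun a t)) xi _ _ ixi.
  have := h _ _; rewrite (_ : (fun n => _) = fun n => complex.Im (series (fun k => a k * mode xi k) n)); last first.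
    apply/funext => n; rewrite /series /= raddf_sum; apply: eq_bigr => k _.
    by rewrite split_trig /mode; case: (a k) => x y /=; ring.
  under [in X in _ -> X]eq_Rintegral do rewrite /cderive1 /= mulr0 add0r.
  apply.
    by move=> n; under eq_bigr do rewrite addrC; exact: bnd.
  move=> t; apply: eq_cvgn (cvg_Im (@circle_fun_cvg a t Ga)) => n.
  by rewrite /series /= raddf_sum; apply: eq_bigr => k _; exact: Im_circle_term.
Qed.

End CirclePairing.

(** * Existence of a function with prescribed modes *)

Section RieszFischer.
Variable R : realType.
Local Notation mu := (@lebesgue_measure R).
Local Notation per := (@period R : set (measurableTypeR R)).
Implicit Types (xi : R -> R) (t : R).

Lemma Rintegral_fin_num (f : R -> R) : L1_period f ->
  (\int[mu]_(t in per) (f t)%:E = (\int[mu]_(t in per) f t)%R%:E)%E.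
Proof.
by move=> If; rewrite /Rintegral fineK// integrable_fin_num//; exact: measurable_period.
Qed.

(** The sum [f] of the absolute values is integrable by monotone convergence, hence finite almost
    everywhere. It gives convergence of the series and serves as dominating function, up to the
    bound [c] of [g]. *)
Lemma L1_series_cvg (B : nat -> R -> R) (M : R) :
  (forall k, L1_period (B k)) ->
  (forall n, \sum_(0 <= k < n) \int[mu]_(t in per) `|B k t| <= M) ->
  exists xi, L1_period xi /\ forall (g : R -> R) (c : R), continuous g ->
    (forall t, `|g t| <= c) ->
    (fun n => \int[mu]_(t in per) (g t * \sum_(0 <= k < n) B k t)) @ \oo -->
      \int[mu]_(t in per) (g t * xi t).
Proof.
move=> BL1 BM.
have aL1 k : L1_period (fun t => `|B k t|) by exact: integrable_abse (BL1 k).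
pose f t := (\sum_(0 <= k <oo) (`|B k t|)%:E)%E.
have f0 t : (0 <= f t)%E by apply: nneseries_ge0 => k _ _; rewrite lee_fin.
have mB k : measurable_fun per (fun t => (`|B k t|)%:E) := measurable_int _ (aL1 k).
have mf : measurable_fun per f.
  by apply: (@ge0_emeasurable_sum _ _ _ _ (fun k t => (`|B k t|)%:E) xpredT)
    => [k t _ _|k _]; [rewrite lee_fin|exact: mB].
have intf : (\int[mu]_(t in per) f t <= M%:E)%E.
  rewrite integral_nneseries//; last exact: measurable_period.
  apply: lime_le.
    by apply: is_cvg_nneseries => k _ _; apply: integral_ge0.
  near=> n; under eq_bigr do rewrite Rintegral_fin_num//.
  by rewrite sumEFin lee_fin.
have If : mu.-integrable per f.
  apply/integrableP; split => //; under eq_integral do rewrite gee0_abs//.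
  exact: le_lt_trans intf (ltry _).
pose S n t := \sum_(0 <= k < n) B k t.
have SL1 n : L1_period (S n) by exact: L1_sum.
(* The upper limit is measurable without any convergence; it is the sum of the series wherever [f]
   is finite. *)
pose xi t := fine (limn_esup (fun n => (S n t)%:E)).
have mxi : measurable_fun per xi.
  apply: (@measurableT_comp _ _ _ _ _ _ (@fine R)) => //.
  by apply: measurable_fun_limn_esup => n; exact: measurable_int (SL1 n).
have Sf n t : ((`|S n t|)%:E <= f t)%E.
  apply: (@le_trans _ _ (\sum_(0 <= k < n) `|B k t|)%:E).
    by rewrite lee_fin ler_norm_sum.
  by rewrite -sumEFin; apply: nneseries_lim_ge => k _ _; rewrite lee_fin.
have Sxi : {ae mu, forall t, per t -> S ^~ t @ \oo --> xi t}.
  have h : {ae mu, forall t, per t -> f t \is a fin_num}.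
    have h := integrable_ae (@measurable_period R) If.
    exact h.
  move: h; apply: filterS; first exact: (ae_filter_ringOfSetsType mu).
  move=> t ft pt.
  have /cvg_ex[l Sl] : cvgn (S ^~ t).
    apply: normed_cvg; apply: (@nneg_series_cvg _ (fun k => `|B k t|) (fine (f t))) => // n.
    rewrite -lee_fin fineK; last exact: ft.
    by rewrite -sumEFin; apply: nneseries_lim_ge => k _ _; rewrite lee_fin.
  suff -> : xi t = l by [].
  have El : (fun n => (S n t)%:E) @ \oo --> l%:E.
    by apply/fine_cvgP; split => //; exact: nearW.
  by rewrite /xi is_cvg_limn_esupE; [rewrite (cvg_lim _ El)|exact: cvgP El].
have [xiL1 _] := period_dominated SL1 mxi Sxi If (fun n t _ => Sf n t).
exists xi; split => // g c cg gc.
have gSL1 n : L1_period (fun t => g t * S n t) by exact: L1_mul_continuous cg gc (SL1 n).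
have gIf : mu.-integrable per (fun t => c%:E * f t)%E.
  by apply: integrableZl => //; exact: measurable_period.
have [] := @period_dominated _ (fun n t => g t * S n t) (fun t => g t * xi t) _ gSL1 _ _ gIf _.
- by apply: measurable_funM => //; exact: period_measurable.
- move: Sxi; apply: filterS; first exact: (ae_filter_ringOfSetsType mu).
  by move=> t h pt; apply: cvgMr; exact: h.
- move=> n t _; rewrite normrM EFinM; by apply: lee_pmul; rewrite ?Sf// lee_fin.
by [].
Unshelve. all: by end_near. Qed.

(** The series of the [w n] need not converge absolutely in L^1, but grouping frequencies in blocks
    [4^k, 4^(k+1)) helps: orthogonality bounds the squared L^2 norm of a block by 3 pi K / 4^k, so
    its L^1 norm is O(2^-k). Ratio 4 keeps square roots out. *)
Lemma trig_mode_exists (p q : nat -> R) (K : R) :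
  (forall n, (0 < n)%N -> n%:R ^+ 2 * (p n ^+ 2 + q n ^+ 2) <= K) ->
  exists xi, L1_period xi /\ forall n p' q', (0 < n)%N ->
    \int[mu]_(t in per) (trig p' q' n%:R t * xi t) = pi * (p n * p' + q n * q').
Proof.
move=> hK.
pose w n t := trig (p n) (q n) n%:R t.
pose B k t := \sum_((4 ^ k)%N <= n < (4 ^ k.+1)%N) w n t.
have cw n : continuous (w n) by exact: continuous_trig.
have wL1 n : L1_period (w n) by exact: L1_continuous.
have BL1 k : L1_period (B k) by exact: L1_sum.
have w_bound n t : `|w n t| <= `|p n| + `|q n| by exact: trig_bound.
have B_int k (g : R -> R) (c : R) : continuous g -> (forall t, `|g t| <= c) ->
    \int[mu]_(t in per) (g t * B k t) =
    \sum_((4 ^ k)%N <= n < (4 ^ k.+1)%N) \int[mu]_(t in per) (g t * w n t).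
  move=> cg gc; under eq_Rintegral do rewrite mulr_sumr.
  by apply: period_int_sum => n; exact: L1_mul_continuous cg gc (wL1 n).
have four0 k : (0 < 4 ^ k)%N by rewrite expn_gt0.
have K0 : 0 <= K by rewrite (le_trans _ (hK 1%N isT))// mulr_ge0 ?addr_ge0 ?sqr_ge0.
have B2L1 k : L1_period (fun t => B k t * B k t).
  apply: (@L1_mul _ _ _ (\sum_((4 ^ k)%N <= n < (4 ^ k.+1)%N) (`|p n| + `|q n|))) => //.
    exact: L1_measurable.
  by move=> t; rewrite (le_trans (ler_norm_sum _ _ _))//; apply: ler_sum.
have B2 k : \int[mu]_(t in per) (B k t * B k t) <= 3 * pi * K / 4 ^+ k.
  have E : \int[mu]_(t in per) (B k t * B k t) =
      \sum_((4 ^ k)%N <= n < (4 ^ k.+1)%N) pi * (p n ^+ 2 + q n ^+ 2).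
    under eq_Rintegral do rewrite {1}/B mulr_suml.
    rewrite period_int_sum; last first.
      by move=> n; exact: L1_mul_continuous (cw n) (w_bound n) (BL1 k).
    apply: eq_big_nat => n /andP[kn nk].
    have n0 : (0 < n)%N by exact: leq_trans (four0 k) kn.
    rewrite (B_int _ _ (`|p n| + `|q n|))// (bigD1_seq n) ?mem_index_iota ?iota_uniq ?kn//=.
    rewrite period_int_trigM// eqxx -!expr2 big1_seq ?addr0// => m /andP[mn].
    rewrite mem_index_iota => /andP[km _].
    by rewrite period_int_trigM//; [rewrite eq_sym (negbTE mn)|exact: leq_trans (four0 k) km].
  (* The block has 3 * 4^k indices, all at least 4^k, so each term is at most pi K / 16^k. *)
  rewrite E; apply: (@le_trans _ _ (\sum_((4 ^ k)%N <= n < (4 ^ k.+1)%N) pi * (K / 16 ^+ k))).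
    rewrite big_nat [leRHS]big_nat; apply: ler_sum => n /andP[kn _].
    have n0 : (0 < n)%N by exact: leq_trans (four0 k) kn.
    rewrite ler_pM2l ?pi_gt0// ler_pdivlMr ?exprn_gt0// mulrC.
    apply: le_trans (hK n n0); rewrite ler_wpM2r ?addr_ge0 ?sqr_ge0//.
    rewrite (_ : 16 = 4%:R ^+ 2); last by rewrite -natrX.
    by rewrite exprAC ler_pXn2r ?nnegrE ?exprn_ge0// -natrX ler_nat.
  rewrite sumr_const_nat expnS -[X in (_ - X)%N]mul1n -mulnBl -[leLHS]mulr_natr natrM natrX.
  rewrite (_ : 16 = 4%:R * 4%:R); last by rewrite -natrM.
  have h4 : 4%:R ^+ k != 0 :> R by rewrite expf_neq0// pnatr_eq0.
  by rewrite exprMn le_eqVlt; apply/orP; left; apply/eqP; rewrite (_ : (4 - 1)%:R = 3)//; field.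
(* With e = 2^-k, integrating |B| <= e/2 + B^2 / (2 e) over the period gives at most pi e + 3 pi K /
   (2 e 4^k); since 4^-k = e^2 this is C e. *)
pose C := pi + 3 * pi * K / 2.
have pi0 : 0 < pi :> R := pi_gt0 R.
have C0 : 0 <= C by rewrite /C; have : 0 <= pi * K by [rewrite mulr_ge0// ltW]; lra.
have aBL1 k : L1_period (fun t => `|B k t|) by exact: integrable_abse (BL1 k).
have B1 k : \int[mu]_(t in per) `|B k t| <= C * 2^-1 ^+ k.
  have e0 : 0 < 2^-1 ^+ k :> R by rewrite exprn_gt0// invr_gt0.
  set e := 2^-1 ^+ k in e0 *.
  have cL1 : L1_period (fun=> e / 2) by apply: L1_continuous => t; exact: cvg_cst.
  apply: (@le_trans _ _ (\int[mu]_(t in per) (e / 2 + (2 * e)^-1 * (B k t * B k t)))).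
    apply: le_Rintegral; [exact: measurable_period|exact: aBL1| |].
      by apply: L1D => //; exact: L1Z.
    move=> t _; rewrite -(@ler_pM2l _ (2 * e)) ?mulr_gt0//.
    have -> : 2 * e * (e / 2 + (2 * e)^-1 * (B k t * B k t)) = e ^+ 2 + B k t ^+ 2.
      by field; rewrite gt_eqF.
    by have := sqr_ge0 (`|B k t| - e); rewrite sqrrB real_normK ?num_real//; lra.
  rewrite RintegralD; [|exact: measurable_period|exact: cL1|exact: L1Z].
  rewrite (RintegralZl _ (@measurable_period R) (B2L1 k)) period_int_cst.
  apply: (@le_trans _ _ (e / 2 * (2 * pi) + (2 * e)^-1 * (3 * pi * K / 4 ^+ k))).
    by rewrite lerD2l ler_wpM2l// invr_ge0 mulr_ge0// ltW.
  have -> : 4 ^+ k = e^-1 * e^-1 :> R.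
    by rewrite /e -exprVn invrK -exprMn; congr (_ ^+ _); rewrite -natrM.
  rewrite le_eqVlt; apply/orP; left; apply/eqP; rewrite /C; field.
  by rewrite gt_eqF.
have geom n : \sum_(0 <= k < n) (2^-1 ^+ k : R) = 2 - 2 * 2^-1 ^+ n.
  elim: n => [|n IH]; first by rewrite big_geq// expr0 mulr1 subrr.
  by rewrite big_nat_recr//= IH exprS; field.
have BM n : \sum_(0 <= k < n) \int[mu]_(t in per) `|B k t| <= C * 2.
  apply: (@le_trans _ _ (\sum_(0 <= k < n) C * 2^-1 ^+ k)); first exact: ler_sum.
  by rewrite -mulr_sumr geom ler_wpM2l// gerBl mulr_ge0// exprn_ge0.
have [xi [xiL1 xiE]] := L1_series_cvg BL1 BM.
exists xi; split => // n p' q' n0.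
have ct : continuous (trig p' q' n%:R) by exact: continuous_trig.
have bt t : `|trig p' q' n%:R t| <= `|p'| + `|q'| by exact: trig_bound.
have SE N t : \sum_(0 <= k < N) B k t = \sum_(1 <= m < (4 ^ N)%N) w m t.
  elim: N => [|N IH]; first by rewrite !big_geq.
  rewrite big_nat_recr//= IH /B -big_cat_nat//=.
  by rewrite leq_exp2l.
have h := xiE _ _ ct bt.
rewrite -(cvg_lim (@Rhausdorff R) h); apply: cvg_lim; first exact: Rhausdorff.
(* For N >= n one has n < 4^N: the partial sum already contains the frequency [n], and by
   orthogonality the integral no longer changes. *)
apply/cvgrPdist_lt => e e0; exists n => // N /= nN.
have nlt : (n < 4 ^ N)%N by exact: leq_ltn_trans nN (ltn_expl _ _).
have -> : \int[mu]_(t in per) (trig p' q' n%:R t * \sum_(0 <= k < N) B k t) =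
    pi * (p n * p' + q n * q').
  under eq_Rintegral do rewrite SE mulr_sumr.
  rewrite period_int_sum; last first.
    by move=> m; exact: L1_mul_continuous ct bt (wL1 m).
  rewrite (bigD1_seq n) ?mem_index_iota ?iota_uniq ?n0 ?nlt//=.
  rewrite period_int_trigM// eqxx (mulrC p') (mulrC q') big1_seq ?addr0// => m /andP[mn].
  rewrite mem_index_iota => /andP[m0 _].
  by rewrite period_int_trigM//; rewrite eq_sym (negbTE mn).
by rewrite subrr normr0.
Qed.

Local Open Scope complex_scope.

(** Mode n has real part - pi n q_n and imaginary part pi n p_n; solving for p_n and q_n brings in
    the 1/n. Mode 0 vanishes identically, whence the condition on [tau 0]. *)
Lemma mode_exists (tau : nat -> R[i]) (K : R) : (forall n, nrm (tau n) <= K) -> tau 0%N = 0 ->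
  exists xi, L1_period xi /\ forall n, mode xi n = tau n.
Proof.
move=> tK t0.
have pi0 : pi != 0 :> R by rewrite gt_eqF// pi_gt0.
have [|xi [xiL1 xiE]] := @trig_mode_exists (fun n => complex.Im (tau n) / (n%:R * pi))
   (fun n => - complex.Re (tau n) / (n%:R * pi)) (K ^+ 2 / pi ^+ 2).
  move=> n n0; have n0' : n%:R != 0 :> R by rewrite pnatr_eq0 -lt0n.
  have -> : n%:R ^+ 2 * ((complex.Im (tau n) / (n%:R * pi)) ^+ 2 +
     (- complex.Re (tau n) / (n%:R * pi)) ^+ 2) = nrm (tau n) ^+ 2 / pi ^+ 2.
    by rewrite sqr_nrmE; move: (@pi R) pi0 => P P0; field; rewrite n0' P0.
  rewrite ler_wpM2r ?invr_ge0 ?sqr_ge0// ler_pXn2r ?nnegrE ?nrm_ge0//.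
  exact: le_trans (nrm_ge0 _) (tK n).
exists xi; split => // -[|n].
  rewrite t0 /mode; apply/eqP; rewrite eq_complex /=; apply/andP; split; apply/eqP.
    under eq_Rintegral do rewrite /trig oppr0 !mul0r addr0 mul0r.
    by rewrite period_int_cst mul0r.
  under eq_Rintegral do rewrite /trig !mul0r addr0 mul0r.
  by rewrite period_int_cst mul0r.
have n0 : n.+1%:R != 0 :> R by rewrite pnatr_eq0.
rewrite /mode !xiE//; case: (tau n.+1) => x y /=.
by congr (_ +i* _); move: (@pi R) pi0 (n.+1%:R : R) n0 => P P0 N N0; field; rewrite N0 P0.
Qed.

End RieszFischer.

(** * Abel sums of the sawtooth series *)

Section AbelSawtooth.
Variable R : realType.
Implicit Types (r s t x : R) (N n : nat).

(** For r < 1 this is - Im log (1 - r e^{it}), the sum of r^n sin(n t) / n over n >= 1. At r = 1 it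
    is the sawtooth itself, equal to 0 at the jumps because division by 0 gives 0. *)
Definition abel_saw r t : R := atan (r * sin t / (1 - r * cos t)).

Definition abel_sum r N t : R := \sum_(0 <= n < N) trig 0 (r ^+ n.+1 / n.+1%:R) n.+1%:R t.

(** The Poisson denominator |1 - r e^{it}|^2. *)
Let den r t : R := 1 - 2 * r * cos t + r ^+ 2.

Lemma cos_lt1 r t : 0 <= r < 1 -> 1 - r <= 1 - r * cos t.
Proof.
move=> /andP[r0 r1]; rewrite lerD2l lerN2 -[leRHS]mulr1 ler_wpM2l//.
Qed.

Lemma den_ge r t : 0 <= r < 1 -> (1 - r) ^+ 2 <= den r t.
Proof. by move=> /andP[r0 r1]; rewrite /den; have := cos_le1 t; nra. Qed.

Lemma geometric_cos r N t :
  den r t * (\sum_(0 <= n < N) r ^+ n.+1 * cos (n.+1%:R * t)) =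
  r * cos t - r ^+ 2 - r ^+ N.+1 * cos (N.+1%:R * t) + r ^+ N.+2 * cos (N%:R * t).
Proof.
elim: N => [|N IH].
  by rewrite big_geq// mulr0 expr1 mul1r mul0r cos0; ring.
rewrite big_nat_recr//= mulrDr IH /den.
have -> : cos (N.+2%:R * t) = 2 * cos t * cos (N.+1%:R * t) - cos (N%:R * t).
  have -> : N.+2%:R * t = N.+1%:R * t + t by rewrite -[N.+2%:R]natr1 mulrDl mul1r.
  have -> : N%:R * t = N.+1%:R * t - t by rewrite -[N.+1%:R]natr1 mulrDl mul1r addrK.
  by rewrite cosD cosB; ring.
by rewrite (exprS r N.+2) (exprS r N.+1); ring.
Qed.

Lemma is_derive_abel_sum r N t :
  is_derive t 1 (abel_sum r N) (\sum_(0 <= n < N) r ^+ n.+1 * cos (n.+1%:R * t)).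
Proof.
have := is_derive_sum_nat
  (fun n s => is_derive_trig 0 (r ^+ n.+1 / n.+1%:R) n.+1%:R s) N t.
rewrite (_ : \sum_(0 <= n < N) _ = \sum_(0 <= n < N) r ^+ n.+1 * cos (n.+1%:R * t))//.
apply: eq_bigr => n _; rewrite /trig mulr0 oppr0 mul0r addr0 mulrCA divff ?mulr1//.
Qed.

Lemma is_derive_abel_saw r t : 0 <= r < 1 ->
  is_derive t 1 (abel_saw r) ((r * cos t - r ^+ 2) / den r t).
Proof.
move=> r01; have /andP[r0 r1] := r01.
have c0 : 1 - r * cos t != 0 by rewrite gt_eqF// (lt_le_trans _ (cos_lt1 t r01))// subr_gt0.
have d0 : den r t != 0 by rewrite gt_eqF// (lt_le_trans _ (den_ge t r01))// exprn_gt0// subr_gt0.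
have ds : is_derive t 1 (fun s => r * sin s) (r * cos t) := is_deriveZ r (is_derive_sin t).
have dc : is_derive t 1 (fun s => 1 - r * cos s) (r * sin t).
  have := is_deriveB (@is_derive_cst R R R (1 : R) t 1) (is_deriveZ r (is_derive_cos t)).
  rewrite (_ : _ - _ = fun s => 1 - r * cos s)// (_ : 0 - _ = r * sin t)//.
  by rewrite sub0r /GRing.scale /= mulrN opprK.
pose f s := 1 - r * cos s.
have di := is_deriveV (f := f) c0 dc.
pose g : R -> R := (fun s => r * sin s) * (fun s => (f s)^-1).
have dg : is_derive t 1 g _ := is_deriveM ds di.
have h := @is_derive1_comp _ (@atan R) g t _ _ (is_derive1_atan (g t)) dg.
apply: (is_derive_eq h); rewrite -[g t]/(r * sin t / f t) /f.
have s2 : sin t ^+ 2 = 1 - cos t ^+ 2 by rewrite sin2cos2.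
rewrite /GRing.scale /=.
have E : 1 + (r * sin t / (1 - r * cos t)) ^+ 2 = den r t / (1 - r * cos t) ^+ 2.
  rewrite !exprMn s2 /den; field.
  by [].
rewrite E; move: s2 c0 d0; rewrite /den; move: (sin t) (cos t) => S c s2 c0 d0.
by field: s2; rewrite d0 c0.
Qed.

(** Both functions vanish at 0, and by [geometric_cos] their derivatives differ by two terms of size
    at most r^N over [den r t]. The mean value theorem concludes. *)
Lemma abel_sum_dist r N t : 0 <= r < 1 ->
  `|abel_sum r N t - abel_saw r t| <= 2 * r ^+ N / (1 - r) ^+ 2 * `|t|.
Proof.
move=> r01; have /andP[r0 r1] := r01.
have d0 s : 0 < den r s by rewrite (lt_le_trans _ (den_ge s r01))// exprn_gt0// subr_gt0.
have D s := is_deriveB (is_derive_abel_sum r N s) (is_derive_abel_saw s r01).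
have := increment_bound (c := 2 * r ^+ N / (1 - r) ^+ 2) t 0 D.
rewrite subr0 (_ : (abel_sum r N - abel_saw r) 0 = 0); last first.
  rewrite -[LHS]/(abel_sum r N 0 - abel_saw r 0) /abel_saw sin0 mulr0 mul0r atan0 subr0.
  by rewrite /abel_sum big1// => n _; rewrite /trig mulr0 sin0 mulr0 mul0r addr0.
rewrite subr0; apply => s.
set S := \sum_(_ <= _ < _) _.
have -> : S = (r * cos s - r ^+ 2 - r ^+ N.+1 * cos (N.+1%:R * s) + r ^+ N.+2 * cos (N%:R * s)) / den r s.
  by rewrite -geometric_cos mulrAC divff ?mul1r// gt_eqF.
rewrite -mulrBl normrM normfV (gtr0_norm (d0 s)).
apply: ler_pM; rewrite ?invr_ge0 ?(ltW (d0 s))//.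
  have -> : r * cos s - r ^+ 2 - r ^+ N.+1 * cos (N.+1%:R * s) + r ^+ N.+2 * cos (N%:R * s) -
      (r * cos s - r ^+ 2) = r ^+ N.+2 * cos (N%:R * s) - r ^+ N.+1 * cos (N.+1%:R * s) by ring.
  have rN m : 0 <= r ^+ m by exact: exprn_ge0.
  have le m k (y : R) : `|r ^+ (m + k) * cos y| <= r ^+ m.
    rewrite normrM ger0_norm// exprD -mulrA ler_piMr// mulr_ile1//.
      by rewrite exprn_ile1// ltW.
    exact: cos_max.
  rewrite (le_trans (ler_normB _ _))// [leRHS]mulr_natl mulr2n lerD//.
    by have := le N 2 (N%:R * s); rewrite addn2.
  by have := le N 1%N (N.+1%:R * s); rewrite addn1.
by rewrite lef_pV2 ?posrE ?exprn_gt0 ?subr_gt0//; exact: den_ge.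
Qed.

Lemma abel_sum_cvg r t : 0 <= r < 1 -> abel_sum r ^~ t @ \oo --> abel_saw r t.
Proof.
move=> r01; have /andP[r0 r1] := r01; apply/cvgrPdist_lt => e e0.
have h : (fun N => 2 / (1 - r) ^+ 2 * `|t| * r ^+ N) @ \oo --> (0 : R).
  rewrite -(mulr0 (2 / (1 - r) ^+ 2 * `|t|)); apply: cvgMr.
  by apply: cvg_expr; rewrite ger0_norm.
have [M hM] := cvg0_eventually h e0; exists M => // N MN.
apply: le_lt_trans (hM N MN); rewrite distrC (le_trans (abel_sum_dist N t r01))//.
by rewrite le_eqVlt; apply/orP; left; apply/eqP; ring.
Qed.

Lemma abel_sum_bound r N t : 0 <= r < 1 -> `|abel_sum r N t| <= (1 - r)^-1.
Proof.
move=> /andP[r0 r1]; rewrite (le_trans (ler_norm_sum _ _ _))//.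
have r1' : 0 < 1 - r by rewrite subr_gt0.
apply: (@le_trans _ _ (\sum_(0 <= n < N) r ^+ n)).
  apply: ler_sum => n _; rewrite (le_trans (trig_bound _ _ _ _))// normr0 add0r.
  rewrite ger0_norm ?divr_ge0 ?exprn_ge0// ler_pdivrMr// exprS mulrC ler_wpM2l ?exprn_ge0//.
  by rewrite (le_trans (ltW r1))// ler1n.
have -> : \sum_(0 <= n < N) r ^+ n = (1 - r ^+ N) / (1 - r).
  elim: N => [|N IH]; first by rewrite big_geq// expr0 subrr mul0r.
  by rewrite big_nat_recr//= IH exprS; field; rewrite gt_eqF.
by rewrite -[leRHS]mul1r ler_pM2r ?invr_gt0// gerBl exprn_ge0.
Qed.

Lemma abel_saw_bound r t : `|abel_saw r t| <= pi.
Proof.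
have := atan_ltpi2 (r * sin t / (1 - r * cos t)).
have := atan_gtNpi2 (r * sin t / (1 - r * cos t)).
rewrite -/(abel_saw r t) ler_norml; have := pi_gt0 R; lra.
Qed.

Definition abel_radius n : R := 1 - n.+2%:R^-1.

Lemma abel_radius01 n : 0 <= abel_radius n < 1.
Proof.
rewrite /abel_radius subr_ge0 invf_le1 ?ler1n ?ltr0n//=.
Qed.

Lemma abel_saw_cvg t : (fun n => abel_saw (abel_radius n) t) @ \oo --> abel_saw 1 t.
Proof.
have r1 : abel_radius @ \oo --> (1 : R).
  rewrite /abel_radius -[X in _ --> X]subr0; apply: cvgB; first exact: cvg_cst.
  have := @cvg_harmonic R; rewrite -(cvg_shiftS (@harmonic R)).
  by apply: cvg_trans.
(* At a jump the limiting quotient has denominator 0, but sin t = 0 makes every term 0. *)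
have [c1|c1] := eqVneq (cos t) 1.
  have s0 : sin t = 0.
    by apply/eqP; rewrite -sqrf_eq0 sin2cos2 c1 expr1n subrr.
  rewrite /abel_saw s0 mulr0 mul0r.
  by under eq_fun do rewrite mulr0 mul0r; exact: cvg_cst.
have h : (fun n => abel_radius n * sin t / (1 - abel_radius n * cos t)) @ \oo --> 1 * sin t / (1 - 1 * cos t).
  apply: cvgM; first exact: cvgMl.
  apply: cvgV; first by rewrite mul1r subr_eq0 eq_sym.
  by apply: cvgB; [exact: cvg_cst|exact: cvgMl].
have ca : {for 1 * sin t / (1 - 1 * cos t), continuous (@atan R)} by exact: continuous_atan.
exact: (@cvg_comp _ _ _ (fun n => abel_radius n * sin t / (1 - abel_radius n * cos t)) (@atan R)
  _ _ _ h ca).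
Qed.

(** Half-angle formulas turn sin t / (1 - cos t) into tan ((pi - t) / 2), whose argument lies in the
    range of [atan]. *)
Lemma saw_val t : 0 < t < 2 * pi -> abel_saw 1 t = (pi - t) / 2.
Proof.
move=> /andP[t0 t2]; rewrite /abel_saw !mul1r.
pose y : R := t / 2.
have ty : t = y *+ 2 by rewrite /y mulr2n; lra.
have s0 : sin y != 0.
  rewrite gt_eqF// sin_gt0_pi// /y; apply/andP; split; lra.
have -> : sin t / (1 - cos t) = tan ((pi - t) / 2).
  rewrite ty sin_mulr2n cos_mulr2n /tan.
  have -> : (pi - y *+ 2) / 2 = pi / 2 - y by rewrite mulr2n; lra.
  rewrite sinB cosB sin_pihalf cos_pihalf !mul0r !mul1r subr0 add0r.
  have -> : 1 - (cos y ^+ 2 *+ 2 - 1) = sin y ^+ 2 *+ 2.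
    by rewrite sin2cos2; ring.
  by move: (sin y) (cos y) s0 => S c s0; field.
rewrite tanK//; rewrite in_itv /=; apply/andP; split; lra.
Qed.

Lemma saw_periodic t : abel_saw 1 (t + 2 * pi) = abel_saw 1 t.
Proof. by rewrite /abel_saw mulr_natl sinD2pi cosD2pi. Qed.

End AbelSawtooth.

(** * Functions with vanishing Fourier coefficients *)

Section FourierUniqueness.
Variable R : realType.
Local Notation mu := (@lebesgue_measure R).
Local Notation per := (@period R : set (measurableTypeR R)).
Implicit Types (h : R -> R) (t x : R).

Lemma bounded_cvg_pairing (phi_ : nat -> R -> R) (phi h : R -> R) (c : R) :
  (forall n, measurable_fun per (phi_ n)) -> (forall n t, `|phi_ n t| <= c) ->
  (forall t, phi_ ^~ t @ \oo --> phi t) -> L1_period h ->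
  (fun n => \int[mu]_(t in per) (phi_ n t * h t)) @ \oo --> \int[mu]_(t in per) (phi t * h t).
Proof.
move=> mphi phic phicvg hL1.
have mphi0 : measurable_fun per phi.
  by apply: (measurable_fun_cvg mphi) => t _; exact: phicvg.
have ah : L1_period (fun t => `|h t|) := integrable_abse hL1.
have gL1 : mu.-integrable per (fun t => (c * `|h t|)%:E) := L1Z c ah.
have [] := @period_dominated _ (fun n t => phi_ n t * h t) (fun t => phi t * h t) _ _ _ _ gL1 _.
- by move=> n; exact: L1_mul (mphi n) (phic n) hL1.
- by apply: measurable_funM => //; exact: L1_measurable.
- by apply: aeW => t _; apply: cvgMl; exact: phicvg.
- by move=> n t _; rewrite lee_fin normrM ler_wpM2r.
by [].
Qed.

Lemma trig_shift (q k t x : R) :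
  trig 0 q k (t - x) = trig (- (q * sin (k * x))) (q * cos (k * x)) k t.
Proof. by rewrite /trig mulrBr sinB; ring. Qed.

Lemma continuous_shift (f : R -> R) x : continuous f -> continuous (fun t => f (t - x)).
Proof.
move=> cf t; apply: (@cvg_comp _ _ _ (fun s => s - x) f _ _ _ _ (cf (t - x))).
by apply: cvgB; [exact: cvg_id|exact: cvg_cst].
Qed.

Lemma ae_neq (a : R) : {ae mu, forall t, t != a}.
Proof.
exists [set a]; split; [exact: measurable_set1|exact: lebesgue_measure_set1|].
by move=> t /= /negP; rewrite negbK => /eqP.
Qed.

Lemma ae_inner_period : {ae mu, forall t, per t -> 0 < t < 2 * pi}.
Proof.
move: (ae_neq 0) (ae_neq (2 * pi)); apply: filterS2; first exact: (ae_filter_ringOfSetsType mu).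
move=> t t0 t2; rewrite /period /= in_itv /= => /andP[h0 h2].
by rewrite !lt_neqAle h0 h2 t2 eq_sym t0.
Qed.

Section ZeroModes.
Variable h : R -> R.
Hypothesis hL1 : L1_period h.
Hypothesis h0 : forall n p q, (0 < n)%N -> \int[mu]_(t in per) (trig p q n%:R t * h t) = 0.

Lemma int_abel_sum r N x : \int[mu]_(t in per) (abel_sum r N (t - x) * h t) = 0.
Proof.
pose w n t := trig (- (r ^+ n.+1 / n.+1%:R * sin (n.+1%:R * x)))
  (r ^+ n.+1 / n.+1%:R * cos (n.+1%:R * x)) n.+1%:R t * h t.
transitivity (\int[mu]_(t in per) (\sum_(0 <= n < N) w n t)).
  apply: eq_Rintegral => t _; rewrite /abel_sum mulr_suml; apply: eq_bigr => n _.
  by rewrite trig_shift.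
rewrite period_int_sum.
  by rewrite big1// => n _; exact: h0.
by move=> n; exact: L1_trigM.
Qed.

Lemma int_abel_saw r x : 0 <= r < 1 -> \int[mu]_(t in per) (abel_saw r (t - x) * h t) = 0.
Proof.
move=> r01.
have c N : continuous (fun t => abel_sum r N (t - x)).
  apply: continuous_shift; apply: continuous_sum_nat => k; exact: continuous_trig.
have := @bounded_cvg_pairing (fun N t => abel_sum r N (t - x)) (fun t => abel_saw r (t - x)) h
  (1 - r)^-1 (fun N => period_measurable (c N)) (fun N t => abel_sum_bound N _ r01)
  (fun t => @abel_sum_cvg _ r (t - x) r01) hL1.
under eq_fun do rewrite int_abel_sum.
move=> H; rewrite -(cvg_lim (@Rhausdorff R) H).
by apply: cvg_lim; [exact: Rhausdorff|exact: cvg_cst].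
Qed.

Lemma measurable_abel_saw r x : 0 <= r < 1 -> measurable_fun per (fun t => abel_saw r (t - x)).
Proof.
move=> r01; apply: period_measurable; apply: continuous_shift => t.
apply: differentiable_continuous; apply/derivable1_diffP.
by case: (is_derive_abel_saw t r01).
Qed.

(** Two successive limits are taken: the bound (1 - r)^-1 used for N tending to infinity blows up at
    r = 1, whereas the closed form is bounded by pi uniformly in [r]. *)
Lemma int_saw x : \int[mu]_(t in per) (abel_saw 1 (t - x) * h t) = 0.
Proof.
have := @bounded_cvg_pairing (fun n t => abel_saw (abel_radius R n) (t - x)) (fun t => abel_saw 1 (t - x)) h
  pi (fun n => measurable_abel_saw x (abel_radius01 R n)) (fun n t => abel_saw_bound _ _)
  (fun t => @abel_saw_cvg _ (t - x)) hL1.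
under eq_fun do rewrite (int_abel_saw _ (abel_radius01 R _)).
move=> H; rewrite -(cvg_lim (@Rhausdorff R) H).
by apply: cvg_lim; [exact: Rhausdorff|exact: cvg_cst].
Qed.

Lemma measurable_saw x : measurable_fun per (fun t => abel_saw 1 (t - x)).
Proof.
apply: (@measurable_fun_cvg _ _ _ _ (fun n t => abel_saw (abel_radius R n) (t - x))).
  by move=> n; exact: measurable_abel_saw (abel_radius01 R n).
by move=> t _; exact: abel_saw_cvg.
Qed.

Hypothesis h00 : \int[mu]_(t in per) h t = 0.

(** The two sawtooths have the same slope, so only their jumps at 0 and x remain. For t < x,
    periodicity brings t - x back into ]0, 2 pi[. *)
Lemma saw_diff x t : 0 < x < 2 * pi -> 0 < t < 2 * pi -> t != x ->
  abel_saw 1 t - abel_saw 1 (t - x) = - (x / 2) + pi * (\1_(`[0, x] : set R) t : R).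
Proof.
move=> /andP[x0 x2] /andP[t0 t2] tx; rewrite (@saw_val _ t) ?t0//.
have [lt|lt|E] := ltgtP t x; last by rewrite E eqxx in tx.
  rewrite -saw_periodic saw_val; last by apply/andP; split; lra.
  rewrite indicE mem_set; first by rewrite mulr1; lra.
  by rewrite /= in_itv /= (ltW t0) (ltW lt).
rewrite saw_val; last by apply/andP; split; lra.
rewrite indicE memNset; first by rewrite mulr0; lra.
by rewrite /= in_itv /= => /andP[_]; rewrite leNgt lt.
Qed.

(** Integrating [saw_diff] against [h], the left side vanishes by [int_saw] and the constant - x/2
    contributes nothing because [h] has mean 0. *)
Lemma int_initial_segment x : 0 < x < 2 * pi ->
  \int[mu]_(t in per) ((\1_(`[0, x] : set R) t : R) * h t) = 0.
Proof.
move=> x02; have /andP[x0 x2] := x02.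
have bs r t : `|abel_saw r t| <= pi :> R by exact: abel_saw_bound.
have L1s y : L1_period (fun t => abel_saw 1 (t - y) * h t).
  by apply: L1_mul (measurable_saw y) _ hL1 => t.
have i1 : measurable_fun per (\1_(`[0, x] : set R) : R -> R).
  by apply: measurable_indic; exact: measurable_itv.
have L1i : L1_period (fun t => (\1_(`[0, x] : set R) t : R) * h t).
  apply: (L1_mul i1 (C := 1)) => // t; rewrite indicE; case: (_ \in _) => /=.
    by rewrite normr1.
  by rewrite normr0.
have E : \int[mu]_(t in per) (abel_saw 1 (t - 0) * h t - abel_saw 1 (t - x) * h t) =
  \int[mu]_(t in per) (- (x / 2) * h t + pi * ((\1_(`[0, x] : set R) t : R) * h t)).
  rewrite /Rintegral; congr fine; apply: ae_eq_integral.
  - exact: measurable_period.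
  - exact: measurable_int (L1B (L1s 0) (L1s x)).
  - exact: measurable_int (L1D (L1Z _ hL1) (L1Z _ L1i)).
  - move: (ae_neq x) ae_inner_period; apply: filterS2; first exact: (ae_filter_ringOfSetsType mu).
    move=> t tx h02 pt; congr EFin.
    by rewrite -mulrBl subr0 (saw_diff x02 (h02 pt) tx) mulrDl mulrA.
have mp := @measurable_period R.
move: E; rewrite (RintegralB mp (L1s 0) (L1s x)) !int_saw subrr.
rewrite (RintegralD mp (L1Z _ hL1) (L1Z _ L1i)) (RintegralZl _ mp hL1) h00 mulr0 add0r.
rewrite (RintegralZl _ mp L1i) => /esym/eqP; rewrite mulf_eq0 gt_eqF ?pi_gt0//=.
by move/eqP.
Qed.

(** Extended by zero, [h] has a primitive [F] that vanishes on ]0, 2 pi[, so F' = 0 there, while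
    Lebesgue differentiation gives F' = h almost everywhere. *)
Lemma zero_modes_ae : {ae mu, forall t, per t -> h t = 0}.
Proof.
have mp := @measurable_period R.
pose f := h \_ (per : set R).
have fT : mu.-integrable [set: R] (EFin \o f).
  by rewrite -restrict_EFin; apply/(integrable_mkcond _ mp).1.
have fint (y : R) : mu.-integrable [set` Interval (BLeft 0) (BRight y)] (EFin \o f).
  by apply: integrableS fT => //; exact: measurable_itv.
have floc : locally_integrable [set: R] f by exact: integrable_locally mp hL1.
pose F (y : R) := \int[mu]_(t in [set` Interval (BLeft 0) (BRight y)]) f t.
have F0 y : 0 < y < 2 * pi -> F y = 0.
  move=> y02; rewrite /F /f -Rintegral_mkcondr Rintegral_mkcondl.
  rewrite -[RHS](int_initial_segment y02); apply: eq_Rintegral => t _.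
  rewrite patchE indicE; case: (_ \in _); first by rewrite mul1r.
  by rewrite mul0r.
have := FTC1 fint floc; move: ae_inner_period; apply: filterS2.
  exact: (ae_filter_ringOfSetsType mu).
move=> t h02 ht pt; have t02 := h02 pt; have /andP[t0 t2] := t02.
have [|_ dF] := ht; first by rewrite /= lte_fin.
move: dF; rewrite derive1E (@near_eq_derive _ _ _ _ (cst 0)); last first.
  have : t \in `]0, 2 * pi[ by rewrite in_itv /= t0 t2.
  move=> /near_in_itvoo; apply: filterS => y; rewrite in_itv /=; exact: F0.
by rewrite derive_cst /f patchE mem_set.
Qed.

End ZeroModes.

(** The constant is the mean of [h]; subtracting it leaves the positive frequencies untouched. *)
Lemma zero_modes_ae_cst (h : R -> R) : L1_period h ->
  (forall n p q, (0 < n)%N -> \int[mu]_(t in per) (trig p q n%:R t * h t) = 0) ->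
  exists c, {ae mu, forall t, per t -> h t = c}.
Proof.
move=> hL1 h0; have mp := @measurable_period R.
pose c := (\int[mu]_(t in per) h t) / (2 * pi); exists c.
have cL1 : L1_period (fun=> c) by apply: L1_continuous => t; exact: cvg_cst.
have pi0 : 2 * pi != 0 :> R by rewrite gt_eqF// pi2_gt0.
have gL1 := L1B hL1 cL1.
have g0 n p q : (0 < n)%N -> \int[mu]_(t in per) (trig p q n%:R t * (h t - c)) = 0.
  move=> n0; transitivity (\int[mu]_(t in per) (trig p q n%:R t * h t - c * trig p q n%:R t)).
    by apply: eq_Rintegral => t _; ring.
  have t0 : L1_period (trig p q n%:R) by apply: L1_continuous; exact: continuous_trig.
  rewrite (RintegralB mp (L1_trigM _ _ _ hL1) (L1Z _ t0)) h0// (RintegralZl _ mp t0).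
  rewrite period_int_trig ?mulr0 ?subrr// ?sin_n2pi ?cos_n2pi//.
  by rewrite pnatr_eq0 -lt0n.
have g00 : \int[mu]_(t in per) (h t - c) = 0.
  by rewrite (RintegralB mp hL1 cL1) period_int_cst /c divfK// subrr.
have := zero_modes_ae gL1 g0 g00; apply: filterS; first exact: (ae_filter_ringOfSetsType mu).
by move=> t ht pt; apply/eqP; rewrite -subr_eq0 ht.
Qed.

End FourierUniqueness.

(** * The spectral shift function *)

Section ModeUniqueness.
Variable R : realType.
Local Notation mu := (@lebesgue_measure R).
Local Notation per := (@period R : set (measurableTypeR R)).
Local Open Scope complex_scope.
Implicit Types xi : R -> R.

(** Here reality of [xi] enters: one complex mode determines both the cosine and the sine
    coefficient. *)
Lemma trig_pairing_mode xi n p q : L1_period xi -> (0 < n)%N ->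
  \int[mu]_(t in per) (trig p q n%:R t * xi t) =
  p / n%:R * complex.Im (mode xi n) - q / n%:R * complex.Re (mode xi n).
Proof.
move=> xiL1 n0; have mp := @measurable_period R.
rewrite /mode /= -(RintegralZl _ mp (L1_trigM _ _ _ xiL1)) -(RintegralZl _ mp (L1_trigM _ _ _ xiL1)).
rewrite -(RintegralB mp (L1Z _ (L1_trigM _ _ _ xiL1)) (L1Z _ (L1_trigM _ _ _ xiL1))).
have n0' : n%:R != 0 :> R by rewrite pnatr_eq0 -lt0n.
by apply: eq_Rintegral => t _; rewrite /trig; field.
Qed.

Lemma mode_delta xi n : L1_period xi ->
  Cintegral per (fun t => cderive1 (circle_fun (fun k => (k == n)%:R)) t * (xi t)%:C) =
  mode xi n.
Proof.
move=> xiL1.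
have Gn := @delta_class_G R n.
apply: (cvg_complex_unique (circle_pairing Gn xiL1)).
apply/cvg_complex_nrmP/cvgrPdist_lt => e e0; exists n.+1 => // m /= nm.
rewrite /series /= (bigD1_seq n) ?mem_index_iota ?iota_uniq//= eqxx mul1r.
rewrite big1 ?addr0; last by move=> k /negbTE ->; rewrite mul0r.
by rewrite subrr nrm0 subrr normr0.
Qed.

End ModeUniqueness.

Lemma strict_contraction_bound (R : realType) (H : hilbertType R) (T : H -> H) :
  strict_contraction_operator T -> exists2 r : R, 0 < r < 1 & bounded_by T r.
Proof.
move=> [[Tl _] T1]; have : exists2 r : R, r < 1 & (op_norm T <= r%:E)%E.
  case: (op_norm T) T1 => [r| |]//; last by exists 0; rewrite ?ltr01// leNye.
  by rewrite lte_fin => r1; exists r.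
(* The maximum with 1/2 keeps the bound below 1 and makes it positive even for T = 0, as rescaling
   by its powers requires. *)
move=> [r r1 Tr]; exists (Num.max r 2^-1).
  by rewrite lt_max gt_max r1 invr_gt0 ltr0n orbT/=; lra.
apply: op_norm_le => //; apply: le_trans Tr _.
by rewrite lee_fin le_max lexx.
Qed.

Theorem theorem2p3 (R : realType) (H : hilbertType R)
    (H_separable : separable H) (H_infinite : ~ finite_dimensional H)
    (T T0 : H -> H)
    (T_contraction : contraction_operator T) (T0_strict : strict_contraction_operator T0)
    (T_T0 : trace_class (T \- T0)) :
  (exists xi : R -> R, L1_period xi /\ trace_formula T T0 xi) /\
  (forall xi1 xi2 : R -> R,
      L1_period xi1 -> trace_formula T T0 xi1 ->
      L1_period xi2 -> trace_formula T T0 xi2 ->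
      exists c : R, {ae lebesgue_measure,
        forall t : R, period t -> xi1 t = xi2 t + c}).
Proof.
(* The trace-class hypothesis supplies the orthonormal basis used for adjoints and traces. *)
have [_ [_ [e [_ eONB _]]]] := T_T0.
split.
  have T1 : bounded_by T 1 by case: T_contraction => -[Tl _]; exact: op_norm_le.
  have [r r01 T0r] := strict_contraction_bound T0_strict.
  have [M VM] := trace_class_tn_le T_T0.
  have [tau [htau tauK tau0]] := pow_diff_trace eONB T1 r01 T0r VM.
  have [xi [xiL1 xiE]] := mode_exists tauK tau0.
  exists xi; split => [|a Ga]; first exact: xiL1.
  refine (op_fun_trace eONB T1 r01 T0r VM htau Ga _).
  have := circle_pairing Ga xiL1.
  by under [X in series X]eq_fun do rewrite xiE.
move=> xi1 xi2 L1 tr1 L2 tr2.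
(* Testing with phi(z) = z^n: both modes are the trace of the same operator. *)
have modeE n : mode xi1 n = mode xi2 n.
  have Gn := @delta_class_G R n.
  rewrite -(mode_delta n L1) -(mode_delta n L2).
  exact: is_trace_unique eONB (tr1 _ Gn) (tr2 _ Gn).
have [||c hc] := @zero_modes_ae_cst R (fun t => xi1 t - xi2 t); first exact: L1B.
  move=> n p q n0.
  under eq_Rintegral do rewrite mulrBr.
  rewrite (RintegralB (@measurable_period R) (L1_trigM _ _ _ L1) (L1_trigM _ _ _ L2)).
  by rewrite !trig_pairing_mode// modeE subrr.
exists c; move: hc; apply: filterS; first exact: (ae_filter_ringOfSetsType lebesgue_measure).
by move=> t ht pt; rewrite -(ht pt) addrC subrK.
Qed.
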